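(* Let $(L|K,v)$ be a branched pure extension. Then $\Omega=(0)$ if and only if $d(L|K,v)=1$.
   Context: $\Omega$ is the $\mathcal{O}_L$-module of Kähler differentials of the extension $\mathcal{O}_L|\mathcal{O}_K$ of valuation rings. For a finite valued field extension the defect is $$d(L|K,v)=\frac{[L^h:K^h]}{(vL:vK)\cdot[Lv:Kv]},$$ where $L^h,K^h$ are the henselizations of $L$ and $K$ determined by a fixed extension of $v$ to $\overline K$, $vL,vK$ are the value groups and $Lv,Kv$ the residue fields. A simple algebraic immediate extension $(L|K,v)$, $L=K(\eta)$ (immediate: $vL=vK$ and $Lv=Kv$), is pure immediate in $\eta$ if for every $f\in K[x]$ with $\deg f<[L:K]$ there is $c\in K$ such that for every $b\in K$: $v(\eta-b)\ge v(\eta-c)\Rightarrow v(f(b))=v(f(c))$. The extension is unibranched if $v$ is the unique extension of $v|_K$ to $L$. It is branched pure if it is pure immediate (in some generator $\eta$) but not unibranched. *)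

(* Defs.v *)
From HB Require Import structures.
From mathcomp Require Import all_boot all_order all_algebra all_field.
From mathcomp Require Import ring_quotient generic_quotient.
From mathcomp Require Import boolp classical_sets.
From mathcomp.multinomials Require Import freeg.

Set Implicit Arguments.
Unset Strict Implicit.
Unset Printing Implicit Defensive.

Import Order.TTheory GRing.Theory Num.Theory.

Local Open Scope ring_scope.
Local Open Scope classical_set_scope.
Local Open Scope quotient_scope.

(* [porderZmodType] alone does not relate the order to addition. *)
Record oagType := OrderedAbelianGroup {
  oag_sort :> porderZmodType;
  oag_total : forall x y : oag_sort, (x <= y) || (y <= x);
  oag_leD : forall z x y : oag_sort, x <= y -> z + x <= z + y
}.

(* [option G] stands for the group G with a largest element [None] added. *)
Section WithInfinity.
Variable G : oagType.
Implicit Types a b : option G.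

Definition vle a b : bool :=
  match a, b with
  | _, None => true
  | None, Some _ => false
  | Some x, Some y => x <= y
  end.

Definition vlt a b : bool := ~~ vle b a.

Definition vmin a b : option G := if vle a b then a else b.

Definition vadd a b : option G :=
  match a, b with
  | Some x, Some y => Some (x + y)
  | _, _ => None
  end.

Lemma vle_refl a : vle a a.
Proof. by case: a => /=. Qed.

Lemma vle_trans b a c : vle a b -> vle b c -> vle a c.
Proof. by case: a b c => [a|] [b|] [c|] //=; apply: le_trans. Qed.

Lemma vle_total a b : vle a b || vle b a.
Proof. by case: a b => [a|] [b|] //=; apply: oag_total. Qed.

Lemma vle_vmin c a b : vle c (vmin a b) = vle c a && vle c b.
Proof.
rewrite /vmin; case: ifPn => ab; apply/idP/andP => [ca|[]//]; split => //.
  exact: vle_trans ab.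
by have := vle_total a b; rewrite (negPf ab) /=; apply: vle_trans.
Qed.

Lemma vadd_ge0 a b : vle (Some 0) a -> vle (Some 0) b -> vle (Some 0) (vadd a b).
Proof.
case: a b => [a|] [b|] //= a0 b0; apply: (le_trans a0).
by have := oag_leD a b0; rewrite addr0.
Qed.

Lemma oag_double_eq0 (x : G) : x + x = 0 -> x = 0.
Proof.
move=> xx0; apply/eqP; rewrite eq_le.
by case/orP: (oag_total x 0) => x0; rewrite x0 /= ?andbT;
  have := oag_leD x x0; rewrite xx0 addr0.
Qed.

End WithInfinity.

(* The value map need not be onto [vgroup]; see [value_group]. *)
Record valuation (F : fieldType) := Valuation {
  vgroup : oagType;
  vfun :> F -> option vgroup;
  v_infty : forall x, vfun x = None <-> x = 0;
  vM : forall x y, vfun (x * y) = vadd (vfun x) (vfun y);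
  vD : forall x y, vle (vmin (vfun x) (vfun y)) (vfun (x + y))
}.

Section ValuationTheory.
Variables (F : fieldType) (v : valuation F).

Lemma v0 : v 0 = None.
Proof. exact/v_infty. Qed.

Lemma v1 : v 1 = Some 0.
Proof.
case E: (v 1) => [g|]; last by move/v_infty/eqP: E; rewrite oner_eq0.
have := vM v 1 1; rewrite mulr1 E /= => -[/eqP].
by rewrite -subr_eq0 opprD addrA subrr add0r oppr_eq0 => /eqP ->.
Qed.

Lemma vN1 : v (-1) = Some 0.
Proof.
have := vM v (-1) (-1); rewrite mulrNN mulr1 v1.
by case: (v (-1)) => [g|] //= [/esym/oag_double_eq0 ->].
Qed.

Lemma vN x : v (- x) = v x.
Proof. by rewrite -mulN1r vM vN1; case: (v x) => //= g; rewrite add0r. Qed.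

Definition value_group : set (vgroup v) := [set g | exists x : F, v x = Some g].

Definition valring_pred : pred F := fun x => vle (Some 0) (v x).

Lemma valring_subring_closed : subring_closed valring_pred.
Proof.
split=> [|x y|x y]; rewrite !unfold_in.
- by rewrite /valring_pred v1 vle_refl.
- move=> x0 y0; apply: vle_trans (vD v x (- y)).
  by rewrite vle_vmin vN x0 y0.
- by move=> x0 y0; rewrite /valring_pred vM vadd_ge0.
Qed.

HB.instance Definition _ :=
  GRing.isSubringClosed.Build F valring_pred valring_subring_closed.

Record valring := ValRing { valring_val :> F; valringP : valring_pred valring_val }.

HB.instance Definition _ := [isSub for valring_val].
HB.instance Definition _ := [Choice of valring by <:].
HB.instance Definition _ := [SubChoice_isSubComNzRing of valring by <:].

Definition maxideal : pred valring := fun x => vlt (Some 0) (v (val x)).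

Lemma maxideal_closed : idealr_closed maxideal.
Proof.
split; rewrite ?unfold_in /maxideal /vlt /=.
- by rewrite v0.
- by rewrite v1 negbK vle_refl.
move=> a x y; rewrite !unfold_in /maxideal /= => x0 y0; apply/negP => h.
have := vle_trans (vD v (val a * val x) (val y)) h; rewrite /vmin.
case: ifP => _ h'; last by rewrite /vlt h' in y0.
move: h' x0; rewrite vM /vlt; have := valringP a; rewrite /valring_pred.
case: (v (val a)) (v (val x)) => [g|] [k|] //= g0 gk; case/negP.
by apply: le_trans gk; have := oag_leD k g0; rewrite addr0 addrC.
Qed.

HB.instance Definition _ := isIdealr.Build valring maxideal maxideal_closed.

Definition resfield : Type := {ideal_quot (maxideal : idealr valring)}.
HB.instance Definition _ :=
  GRing.ComNzRing.copy resfield {ideal_quot (maxideal : idealr valring)}.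

Definition res (a : valring) : resfield := \pi_({ideal_quot (maxideal : idealr valring)}) a.

Lemma res_is_zmod_morphism : zmod_morphism res.
Proof. exact: (rmorphB \pi_({ideal_quot (maxideal : idealr valring)})). Qed.

Lemma res_is_monoid_morphism : monoid_morphism res.
Proof.
by split; [apply: (rmorph1 \pi_({ideal_quot (maxideal : idealr valring)}))
  | apply: (rmorphM \pi_({ideal_quot (maxideal : idealr valring)}))].
Qed.

HB.instance Definition _ :=
  GRing.isZmodMorphism.Build valring resfield res res_is_zmod_morphism.
HB.instance Definition _ :=
  GRing.isMonoidMorphism.Build valring resfield res res_is_monoid_morphism.

Fact valring_inv_subproof (a : valring) :
  valring_pred (if a \in maxideal then 0 else (val a)^-1).
Proof.
case: ifPn => [_|]; first by rewrite /valring_pred v0.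
rewrite unfold_in /maxideal /vlt negbK => va0.
have a0 : val a != 0 by apply: contraTneq va0 => ->; rewrite v0.
have := vM v (val a) (val a)^-1; rewrite divff // v1 /valring_pred.
case: (v (val a)) va0 => [g|] //= g0; case: (v _) => [h|] //= [E].
by have := oag_leD h g0; rewrite addr0 addrC -E.
Qed.

Definition valring_inv a : valring := ValRing (valring_inv_subproof a).

Definition resfield_inv (x : resfield) : resfield := res (valring_inv (repr x)).

Lemma res_eq0 a : (res a == 0) = (a \in maxideal).
Proof.
rewrite -(rmorph0 res) /res.
by rewrite -(Quotient.idealrBE (maxideal : idealr valring)) subr0.
Qed.

Lemma res_repr (x : resfield) : res (repr x) = x.
Proof. exact: reprK. Qed.

Lemma resfield_mulVf (x : resfield) : x != 0 -> resfield_inv x * x = 1.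
Proof.
rewrite /resfield_inv -{1 3}[x]res_repr res_eq0 => x0.
rewrite -rmorphM -(rmorph1 res); congr res.
apply/val_inj; rewrite /= (negPf x0) mulVf //.
by apply: contraNneq x0 => x0; rewrite unfold_in /maxideal /= x0 v0.
Qed.

Lemma resfield_inv0 : resfield_inv 0 = 0.
Proof.
have r0 : repr (0 : resfield) \in maxideal by rewrite -res_eq0 res_repr.
apply/eqP; rewrite /resfield_inv res_eq0 unfold_in /maxideal /= r0.
by rewrite v0.
Qed.

HB.instance Definition _ :=
  GRing.ComNzRing_isField.Build resfield resfield_mulVf resfield_inv0.

End ValuationTheory.

Arguments value_group {F} v.
Arguments maxideal {F} v.

Section Restriction.
Variables (F E : fieldType) (f : {rmorphism F -> E}) (v : valuation E).

Fact vrestr_infty x : v (f x) = None <-> x = 0.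
Proof.
by split=> [/v_infty/eqP|->]; rewrite ?rmorph0 ?v0 // fmorph_eq0 => /eqP.
Qed.

Fact vrestr_M x y : v (f (x * y)) = vadd (v (f x)) (v (f y)).
Proof. by rewrite rmorphM vM. Qed.

Fact vrestr_D x y : vle (vmin (v (f x)) (v (f y))) (v (f (x + y))).
Proof. by rewrite rmorphD vD. Qed.

Definition vrestr : valuation F := Valuation vrestr_infty vrestr_M vrestr_D.

Definition valring_map (a : valring vrestr) : valring v :=
  @ValRing E v (f (val a)) (valringP a).

Fact valring_map_is_zmod_morphism : zmod_morphism valring_map.
Proof. by move=> a b; apply/val_inj; rewrite /= rmorphB. Qed.

Fact valring_map_is_monoid_morphism : monoid_morphism valring_map.
Proof.
by split=> [|a b]; apply/val_inj; rewrite /= ?rmorph1 ?rmorphM.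
Qed.

HB.instance Definition _ := GRing.isZmodMorphism.Build
  (valring vrestr) (valring v) valring_map valring_map_is_zmod_morphism.
HB.instance Definition _ := GRing.isMonoidMorphism.Build
  (valring vrestr) (valring v) valring_map valring_map_is_monoid_morphism.

Definition resfield_restr : set (resfield v) :=
  [set res (valring_map a) | a in [set: valring vrestr]].

End Restriction.

Arguments valring_map {F E} f v.
Arguments resfield_restr {F E} f v.

(* Both valuations order the field in the same way, that is, they agree up to
   an isomorphism of their value groups. *)
Definition vequiv (F : fieldType) (v w : valuation F) : Prop :=
  forall x y, vle (v x) (v y) = vle (w x) (w y).

Section Kaehler.
Variables (A B : comNzRingType) (f : {rmorphism A -> B}).

(* The free B-module on symbols [<< b >>] is divided by the relations making
   the class of [<< b >>] the universal A-derivation. *)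
Inductive kaehler_rel : {freeg B / B} -> Prop :=
| kaehler_relD b c : kaehler_rel (<< b + c >> - << b >> - << c >>)
| kaehler_relM b c : kaehler_rel (<< b * c >> - b *: << c >> - c *: << b >>)
| kaehler_relA a : kaehler_rel << f a >>.

Definition kaehler_sub : {pred {freeg B / B}} := fun w =>
  `[< forall N : {pred {freeg B / B}}, submod_closed N ->
        (forall r, kaehler_rel r -> r \in N) -> w \in N >].

Fact kaehler_sub_closed : submod_closed kaehler_sub.
Proof.
split=> [|a x y]; rewrite !unfold_in /kaehler_sub.
  by apply/asboolP => N [].
move=> /asboolP xN /asboolP yN; apply/asboolP => N cN rN.
by apply: cN.2; [apply: xN | apply: yN].
Qed.

HB.instance Definition _ :=
  GRing.isZmodClosed.Build {freeg B / B} kaehler_sub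
    (GRing.submod_closedB kaehler_sub_closed).
HB.instance Definition _ :=
  GRing.isSubmodClosed.Build B {freeg B / B} kaehler_sub kaehler_sub_closed.

Definition kaehler : Type := {ideal_quot (kaehler_sub : zmodClosed {freeg B / B})}.
HB.instance Definition _ := GRing.Zmodule.copy kaehler
  {ideal_quot (kaehler_sub : zmodClosed {freeg B / B})}.

Definition kaehler_class (w : {freeg B / B}) : kaehler :=
  \pi_{ideal_quot (kaehler_sub : zmodClosed {freeg B / B})} w.

Fact kaehler_class_is_zmod_morphism : zmod_morphism kaehler_class.
Proof.
exact: (raddfB \pi_{ideal_quot (kaehler_sub : zmodClosed {freeg B / B})}).
Qed.

HB.instance Definition _ := GRing.isZmodMorphism.Build
  {freeg B / B} kaehler kaehler_class kaehler_class_is_zmod_morphism.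

Lemma kaehler_class_repr (x : kaehler) : kaehler_class (repr x) = x.
Proof. exact: reprK. Qed.

Lemma kaehler_class_eq0 w : (kaehler_class w == 0) = (w \in kaehler_sub).
Proof.
rewrite -(raddf0 kaehler_class) /kaehler_class.
by rewrite -(Quotient.idealrBE (kaehler_sub : zmodClosed {freeg B / B})) subr0.
Qed.

Definition kaehler_scale (b : B) (x : kaehler) : kaehler :=
  kaehler_class (b *: repr x).

Lemma kaehler_scale_class b w :
  kaehler_scale b (kaehler_class w) = kaehler_class (b *: w).
Proof.
apply/eqP; rewrite -subr_eq0 -raddfB -scalerBr kaehler_class_eq0.
by rewrite rpredZ // -kaehler_class_eq0 raddfB /= kaehler_class_repr subrr.
Qed.

Fact kaehler_scaleA a b x :
  kaehler_scale a (kaehler_scale b x) = kaehler_scale (a * b) x.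
Proof. by rewrite -[x]kaehler_class_repr !kaehler_scale_class scalerA. Qed.

Fact kaehler_scale1 : left_id 1 kaehler_scale.
Proof. by move=> x; rewrite /kaehler_scale scale1r kaehler_class_repr. Qed.

Fact kaehler_scaleDr : right_distributive kaehler_scale +%R.
Proof.
move=> a x y; rewrite -[x]kaehler_class_repr -[y]kaehler_class_repr -raddfD.
by rewrite !kaehler_scale_class scalerDr raddfD.
Qed.

Fact kaehler_scaleDl x : {morph kaehler_scale^~ x : a b / a + b}.
Proof. by move=> a b; rewrite /kaehler_scale scalerDl raddfD. Qed.

HB.instance Definition _ := GRing.Zmodule_isLmodule.Build B kaehler
  kaehler_scaleA kaehler_scale1 kaehler_scaleDr kaehler_scaleDl.

Lemma kaehler_classZ b w : kaehler_class (b *: w) = b *: kaehler_class w.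
Proof. by rewrite -kaehler_scale_class. Qed.

Definition kaehler_d (b : B) : kaehler := kaehler_class << b >>.

Definition is_derivation (M : lmodType B) (D : B -> M) : Prop :=
  [/\ forall b c, D (b + c) = D b + D c,
      forall b c, D (b * c) = b *: D c + c *: D b &
      forall a, D (f a) = 0].

Fact kaehler_rel_eq0 w : kaehler_rel w -> kaehler_class w = 0.
Proof.
move=> rw; apply/eqP; rewrite kaehler_class_eq0 unfold_in.
by apply/asboolP => N _; apply.
Qed.

Lemma kaehler_d_derivation : is_derivation kaehler_d.
Proof.
split=> [b c|b c|a]; last exact/kaehler_rel_eq0/kaehler_relA.
  apply/eqP; rewrite -subr_eq0 opprD addrA /kaehler_d -!raddfB.
  exact/eqP/kaehler_rel_eq0/kaehler_relD.
apply/eqP; rewrite -subr_eq0 opprD addrA /kaehler_d.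
rewrite -!kaehler_classZ -!raddfB.
exact/eqP/kaehler_rel_eq0/kaehler_relM.
Qed.

Lemma freeg_span (N : {pred {freeg B / B}}) : submod_closed N ->
  (forall b, << b >> \in N) -> forall w, w \in N.
Proof.
case=> N0 lN Nb; elim/freeg_ind_dom0 => [//|k b w _ _ wN].
suff -> : << k *g b >> = k *: << b >> :> {freeg B / B} by apply: lN.
by apply/eqP/freeg_eqP => x; rewrite coeffZ !coeffU mul1r.
Qed.

Lemma kaehler_universal (M : lmodType B) (D : B -> M) : is_derivation D ->
  exists2 h : {linear kaehler -> M}, forall b, h (kaehler_d b) = D b &
    forall h' : {linear kaehler -> M}, (forall b, h' (kaehler_d b) = D b) ->
      h' =1 h.
Proof.
case=> DD DM DA.
pose g := fglift D : {freeg B / B} -> M.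
have gB u w : g (u - w) = g u - g w by exact: lift_is_additive.
have g0 : g 0 = 0 by rewrite -(subrr 0) gB subrr.
have gD u w : g (u + w) = g u + g w.
  by rewrite -[w in LHS]opprK gB -[- w]sub0r gB g0 sub0r opprK.
have g1 b : g << b >> = D b by rewrite /g liftU scale1r.
have gZ k u : g (k *: u) = k *: g u.
  suff /asboolP : u \in (fun u => `[< forall k, g (k *: u) = k *: g u >]) by apply.
  apply: freeg_span => [|b]; first split=> [|a x y].
  - by apply/asboolP => l; rewrite scaler0 g0 scaler0.
  - move=> /asboolP gx /asboolP gy; apply/asboolP => l.
    by rewrite scalerDr scalerA !gD !gx gy scalerDr scalerA.
  apply/asboolP => l; rewrite g1 -(liftU D) -/g; congr g.
  by apply/eqP/freeg_eqP => x; rewrite coeffZ !coeffU mul1r.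
have gK u : u \in kaehler_sub -> g u = 0.
  move=> /asboolP; move=> /(_ (fun u => g u == 0)) sub; apply/eqP; apply: sub.
    split=> [|a x y]; rewrite !unfold_in ?g0 // gD gZ => /eqP -> /eqP ->.
    by rewrite scaler0 addr0.
  move=> _ [b c|b c|a]; rewrite unfold_in ?gB ?gZ ?g1 ?DD ?DM ?DA //;
    by rewrite -addrA -opprD subrr.
pose h (x : kaehler) := g (repr x).
have hE w : h (kaehler_class w) = g w.
  apply/eqP; rewrite -subr_eq0 -gB gK // -kaehler_class_eq0 raddfB /=.
  by rewrite kaehler_class_repr subrr.
have hl : linear h.
  move=> a x y; rewrite -[x]kaehler_class_repr -[y]kaehler_class_repr.
  rewrite -kaehler_classZ -raddfD !hE.
  by rewrite gD gZ.
pose H : {linear kaehler -> M} := HB.pack h (GRing.isLinear.Build _ _ _ _ h hl).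
exists H => [b|h' h'E x]; first by rewrite /= hE g1.
rewrite -[x]kaehler_class_repr.
pose N : {pred {freeg B / B}} :=
  fun u => `[< h' (kaehler_class u) = H (kaehler_class u) >].
suff: repr x \in N by move/asboolP.
apply: (@freeg_span N) => [|b]; last by apply/asboolP; rewrite h'E /= hE g1.
split=> [|a u w]; first by apply/asboolP; rewrite !raddf0.
move=> /asboolP hu /asboolP hw; apply/asboolP.
have -> : kaehler_class (a *: u + w) = a *: kaehler_class u + kaehler_class w.
  by rewrite -kaehler_classZ -raddfD.
by rewrite !linearP hu hw.
Qed.

End Kaehler.

(* [b] is a basis of E over the subfield k: elements of E have unique
   coordinates in k. *)
Definition is_basis (F : fieldType) (E k : set F) n (b : 'I_n -> F) : Prop :=
  (forall i, E (b i)) /\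
  forall x, E x ->
    exists! c : {ffun 'I_n -> F}, (forall i, k (c i)) /\ x = \sum_i c i * b i.

(* [E : k] for subfields k <= E of F, with value 0 if the degree is infinite. *)
Definition subfield_degree (F : fieldType) (E k : set F) : nat :=
  xget 0%N [set n | exists b : 'I_n -> F, is_basis E k b].

(* (H : H') for subgroups H' <= H of G, counted through a family of
   representatives of the cosets; the value is 0 if the index is infinite. *)
Definition subgroup_index (G : zmodType) (H H' : set G) : nat :=
  xget 0%N [set n | exists g : 'I_n -> G,
    (forall i, H (g i)) /\ forall x, H x -> exists! i, H' (x - g i)].

(* The henselization inside the valued algebraic closure [(C, w)] of F: the
   decomposition field of w, i.e. the fixed field, in the separable closure of
   F in C, of the automorphisms over F which preserve w.  It is harmless to let
   the automorphisms act on all of C, as C is purely inseparable over that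
   separable closure. *)
Definition henselization (F C : fieldType) (j : {rmorphism F -> C})
    (w : valuation C) : set C :=
  [set x | (exists2 p : {poly F}, separable_poly p & root (map_poly j p) x) /\
     forall s : {rmorphism C -> C}, bijective s ->
       (forall a, s (j a) = j a) -> (forall y, w (s y) = w y) -> s x = x].

Section ValuedExtension.
Variables (K : fieldType) (L : fieldExtType K) (v : valuation L).

Definition vbase : valuation K := vrestr (in_alg L) v.

Definition Omega : lmodType (valring v) := kaehler (valring_map (in_alg L) v).

Definition immediate : Prop :=
  value_group vbase = value_group v /\ resfield_restr (in_alg L) v = setT.

(* Uniqueness of extensions is up to equivalence, as usual. *)
Definition unibranched : Prop :=
  forall w : valuation L, vequiv (vrestr (in_alg L) w) vbase -> vequiv w v.

Definition pure_immediate_in (eta : L) : Prop :=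
  [/\ <<1; eta>>%VS = fullv, immediate &
      forall f : {poly K}, (size f <= \dim {:L})%N ->
        exists c : K, forall b : K,
          vle (v (eta - c%:A)) (v (eta - b%:A)) ->
          vbase f.[b] = vbase f.[c]].

Definition branched_pure : Prop :=
  (exists eta, pure_immediate_in eta) /\ ~ unibranched.

Definition defect (C : fieldType) (iota : {rmorphism L -> C})
    (w : valuation C) : rat :=
  (subfield_degree (henselization iota w)
                   (henselization (iota \o in_alg L) w))%:R
  / (subgroup_index (value_group v) (value_group vbase)
     * subfield_degree [set: resfield v] (resfield_restr (in_alg L) v))%N%:R.

End ValuedExtension.

(* Main.v *)
From HB Require Import structures.
Require Import Defs.
From mathcomp Require Import all_boot all_order all_algebra all_field.
From mathcomp Require Import boolp classical_sets.
From mathcomp.multinomials Require Import freeg.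
Import GRing.Theory.
Local Open Scope ring_scope.

Set Implicit Arguments.
Unset Strict Implicit.
Unset Printing Implicit Defensive.

(** Let [eta] be a generator in which the extension is pure immediate, [n] its
    degree, [g] its minimal polynomial, and [t] its image in the algebraic
    closure. Since the extension is immediate, no element of [K] is closest to
    [t]. Call [z] close if it is at least as close to [t] as every element of
    [K], and let [h] be the number of close roots of [g], with multiplicity. The
    two conditions of the theorem are both equivalent to [h = 1].

    Differentials. Purity says that a polynomial over [K] of degree less than [n]
    has no close root ([pure_far]). On a disc [c + a X] around [t] that is small
    enough, such a polynomial is dominated by its constant term ([pure_peak]), so
    the valuation ring of [L] is the increasing union of the rings
    [O_K[(eta - c) / a]], with [c] in [K] approaching [eta] and [a] of the value
    of [eta - c]. Let [P] be [g] read in the coordinate [X] and divided by its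
    Gauss value: its reduction has degree [h]. If [h = 1], then [P'] is a unit at
    [(eta - c) / a], which forces the differential of this element to vanish
    ([Omega_zero]). In general, [f(eta) |-> f'(eta)] for [f] of degree less than
    [n] is a derivation modulo those multiples of [g'(eta)] that arise from
    reducing products modulo [g]; Gauss's lemma bounds them ([quotient_bound]).
    The differential of [(eta - c0) / a0] is nonzero when this bound stays above
    the value of [1 / a0], which is [deriv_gt].

    This last inequality fails for some unibranched extensions. Here the roots of
    [g] are not all close: otherwise the elements [(eta - c) / a] would be
    integral over the valuation ring of [K], and the valuation would have a
    single prolongation ([all_close_unibranched]). Approximating over [K] the
    factor of [g] with the close roots, which has degree [h < n], contradicts
    purity unless the distances from [t] to [K] are cofinal in a coset of a
    convex subgroup ([distances_cofinal]). The differences of [t] with the other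
    close roots lie above that coset, and [g'(eta)] is their product with the
    differences with the far roots; the inequality follows as soon as [h > 1].

    Defect. The extension being immediate, the defect is the degree of the
    henselization of [L] over that of [K]. If [h = 1], every automorphism over
    [K] that preserves the valuation sends [t] to a close root, hence fixes it,
    and the henselizations agree ([henselization_eq]). If they agree, then [t] is
    separable over [K] and fixed by these automorphisms; but purity makes [t] and
    a second close root indistinguishable, so that some such automorphism would
    send one to the other ([degree1_clnum]). Its existence is the conjugacy of the
    prolongations of a valuation to the algebraic closure
    ([corr_automorphism]), which is derived from the fact that the values of the
    coefficients of a polynomial determine those of its roots ([newton_root]). *)

(** * Valuations as divisibility relations *)

(** Everything below is phrased through this preorder (value at most, that is,
    divisibility in the valuation ring): it needs no arithmetic in the value
    group, and it is what equivalent valuations have in common. *)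
Definition dom (F : fieldType) (v : valuation F) (x y : F) : bool :=
  vle (v x) (v y).

Definition sdom (F : fieldType) (v : valuation F) (x y : F) : bool :=
  ~~ dom v y x.

Section Dominance.
Variables (F : fieldType) (v : valuation F).
Local Notation "x ⊑ y" := (dom v x y) (at level 70).
Local Notation "x ⊏ y" := (sdom v x y) (at level 70).
Implicit Types x y z : F.

Lemma dom_refl x : x ⊑ x.
Proof. exact: vle_refl. Qed.

Lemma dom_trans y x z : x ⊑ y -> y ⊑ z -> x ⊑ z.
Proof. exact: vle_trans. Qed.

Lemma dom_total x y : (x ⊑ y) || (y ⊑ x).
Proof. exact: vle_total. Qed.

Lemma sdomW x y : x ⊏ y -> x ⊑ y.
Proof. by move=> /negPf xy; have := dom_total x y; rewrite xy orbF. Qed.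

Lemma sdomNge x y : ~~ (x ⊑ y) = (y ⊏ x).
Proof. by []. Qed.

Lemma sdom_irr x : (x ⊏ x) = false.
Proof. by rewrite /sdom dom_refl. Qed.

Lemma dom_sdom_trans y x z : x ⊑ y -> y ⊏ z -> x ⊏ z.
Proof. by move=> xy; apply: contraNN => zx; apply: dom_trans xy. Qed.

Lemma sdom_dom_trans y x z : x ⊏ y -> y ⊑ z -> x ⊏ z.
Proof. by move=> xy yz; apply: contraNN xy; apply: dom_trans. Qed.

Lemma sdom_trans y x z : x ⊏ y -> y ⊏ z -> x ⊏ z.
Proof. by move=> xy /sdomW; apply: sdom_dom_trans. Qed.

Lemma dom_eq x y : v x = v y -> x ⊑ y.
Proof. by rewrite /dom => ->; apply: vle_refl. Qed.

Lemma dom_anti x y : x ⊑ y -> y ⊑ x -> v x = v y.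
Proof.
rewrite /dom; case: (v x) (v y) => [a|] [b|] //= ab ba; congr Some.
by apply/eqP; rewrite Order.POrderTheory.eq_le ab ba.
Qed.

Lemma veq_dom x y : v x = v y -> (dom v x =1 dom v y) * (dom v ^~ x =1 dom v ^~ y).
Proof. by move=> xy; rewrite /dom; split=> z /=; rewrite xy. Qed.

Lemma veq_sdom x y : v x = v y -> (sdom v x =1 sdom v y) * (sdom v ^~ x =1 sdom v ^~ y).
Proof. by move=> xy; rewrite /sdom /dom; split=> z /=; rewrite xy. Qed.

Lemma dom_x0 x : x ⊑ 0.
Proof. by rewrite /dom v0; case: (v x). Qed.

Lemma dom_0x x : (0 ⊑ x) = (x == 0).
Proof.
apply/idP/eqP => [|->]; last exact: dom_refl.
by rewrite /dom v0; case E: (v x) => [a|] // _; apply/(v_infty v).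
Qed.

Lemma sdom_x0 x : (x ⊏ 0) = (x != 0).
Proof. by rewrite /sdom dom_0x. Qed.

Lemma sdom_neq0 x y : x ⊏ y -> x != 0.
Proof. by move=> xy; rewrite -sdom_x0; apply: sdom_dom_trans xy (dom_x0 _). Qed.

Lemma veq_eq0 x y : v x = v y -> (x == 0) = (y == 0).
Proof. by move=> xy; rewrite -!dom_0x (veq_dom xy). Qed.

Lemma veq_mul x x' y y' : v x = v x' -> v y = v y' -> v (x * y) = v (x' * y').
Proof. by rewrite !vM => -> ->. Qed.

Lemma veq_exp x y n : v x = v y -> v (x ^+ n) = v (y ^+ n).
Proof. by move=> xy; elim: n => // n IHn; rewrite !exprS; apply: veq_mul. Qed.

Lemma veq_prod (I : Type) (r : seq I) (P : pred I) (f g : I -> F) :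
  (forall i, P i -> v (f i) = v (g i)) ->
  v (\prod_(i <- r | P i) f i) = v (\prod_(i <- r | P i) g i).
Proof. by move=> fg; apply: (big_ind2 (fun a b => v a = v b)) => // *; apply: veq_mul. Qed.

Lemma dom_mul2l z x y : z != 0 -> (z * x ⊑ z * y) = (x ⊑ y).
Proof.
move=> z0; rewrite /dom !vM; case E: (v z) => [c|]; last first.
  by move/v_infty/eqP: E; rewrite (negPf z0).
case: (v x) (v y) => [a|] [b|] //=; apply/idP/idP; last exact: oag_leD.
by move/(oag_leD (- c)); rewrite !addrA !addNr !add0r.
Qed.

Lemma sdom_mul2l z x y : z != 0 -> (z * x ⊏ z * y) = (x ⊏ y).
Proof. by move=> z0; rewrite /sdom dom_mul2l. Qed.

Lemma veq_mulIf x y z : z != 0 -> v (x * z) = v (y * z) -> v x = v y.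
Proof.
move=> z0 e; apply: dom_anti; rewrite -(dom_mul2l _ _ z0) ![z * _]mulrC;
  exact: dom_eq.
Qed.

Lemma dom_mul x x' y y' : x ⊑ x' -> y ⊑ y' -> x * y ⊑ x' * y'.
Proof.
have mono z a b : a ⊑ b -> z * a ⊑ z * b.
  by case: (eqVneq z 0) => [->|z0 ab]; rewrite ?mul0r ?dom_refl ?dom_mul2l.
move=> xx' yy'; apply: (@dom_trans (x * y')); first exact: mono.
by rewrite ![_ * y']mulrC; apply: mono.
Qed.

Lemma sdom_dom_mul x x' y y' : y != 0 -> x ⊏ x' -> y ⊑ y' -> x * y ⊏ x' * y'.
Proof.
move=> y0 xx' yy'; apply: (@sdom_dom_trans (x' * y)).
  by rewrite ![_ * y]mulrC sdom_mul2l.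
exact: dom_mul (dom_refl _) yy'.
Qed.

Lemma dom_sdom_mul x x' y y' : x != 0 -> x ⊑ x' -> y ⊏ y' -> x * y ⊏ x' * y'.
Proof.
by move=> x0 xx' yy'; rewrite [x * y]mulrC [x' * y']mulrC; apply: sdom_dom_mul.
Qed.

Lemma dom_exp x y n : x ⊑ y -> x ^+ n ⊑ y ^+ n.
Proof.
by move=> xy; elim: n => [|n IHn]; rewrite ?dom_refl // !exprS dom_mul.
Qed.

Lemma sdom_exp x y n : x ⊏ y -> x ^+ n.+1 ⊏ y ^+ n.+1.
Proof.
move=> xy; have x0 := sdom_neq0 xy.
by rewrite !exprS sdom_dom_mul ?expf_neq0 // dom_exp // sdomW.
Qed.

Lemma dom_exp2r x y n : x ^+ n.+1 ⊑ y ^+ n.+1 -> x ⊑ y.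
Proof. by apply: contraTT => /sdom_exp; apply. Qed.

Lemma veq_exp2r x y n : v (x ^+ n.+1) = v (y ^+ n.+1) -> v x = v y.
Proof.
by move=> xy; apply: dom_anti; apply: (@dom_exp2r _ _ n); apply: dom_eq.
Qed.

Lemma dom_N x y : (x ⊑ - y) = (x ⊑ y).
Proof. by rewrite /dom vN. Qed.

Lemma sdom_N x y : (x ⊏ - y) = (x ⊏ y).
Proof. by rewrite /sdom /dom vN. Qed.

Lemma dom_D z x y : z ⊑ x -> z ⊑ y -> z ⊑ x + y.
Proof. by move=> zx zy; apply: vle_trans (vD v x y); rewrite vle_vmin; apply/andP. Qed.

Lemma dom_B z x y : z ⊑ x -> z ⊑ y -> z ⊑ x - y.
Proof. by move=> zx zy; apply: dom_D => //; rewrite dom_N. Qed.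

Lemma sdom_D z x y : z ⊏ x -> z ⊏ y -> z ⊏ x + y.
Proof.
move=> zx zy; case/orP: (dom_total x y) => xy.
  by apply: sdom_dom_trans zx _; apply: dom_D (dom_refl x) xy.
by apply: sdom_dom_trans zy _; apply: dom_D xy (dom_refl y).
Qed.

Lemma sdom_B z x y : z ⊏ x -> z ⊏ y -> z ⊏ x - y.
Proof. by move=> zx zy; apply: sdom_D => //; rewrite sdom_N. Qed.

Lemma dom_sum z (I : Type) (r : seq I) (P : pred I) (f : I -> F) :
  (forall i, P i -> z ⊑ f i) -> z ⊑ \sum_(i <- r | P i) f i.
Proof. by move=> zf; apply: (big_ind (dom v z)) => //; [apply: dom_x0 | apply: dom_D]. Qed.

Lemma sdom_sum z (I : Type) (r : seq I) (P : pred I) (f : I -> F) : z != 0 ->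
  (forall i, P i -> z ⊏ f i) -> z ⊏ \sum_(i <- r | P i) f i.
Proof.
by move=> z0 zf; apply: (big_ind (sdom v z)) => //; [rewrite sdom_x0 | apply: sdom_D].
Qed.

Lemma veqDl x y : x ⊏ y -> v (x + y) = v x.
Proof.
move=> xy; apply: dom_anti; last by apply: dom_D (dom_refl x) (sdomW xy).
apply: contraT => h.
suff : x ⊏ (x + y) - y by rewrite addrK sdom_irr.
exact: sdom_B.
Qed.

Lemma veqBl x y : x ⊏ y -> v (x - y) = v x.
Proof. by move=> xy; rewrite veqDl // sdom_N. Qed.

Lemma dom_divl x y z : y != 0 -> (x / y ⊑ z) = (x ⊑ y * z).
Proof. by move=> y0; rewrite -(dom_mul2l _ _ y0) mulrC divfK. Qed.

Lemma dom_divr x y z : y != 0 -> (z ⊑ x / y) = (y * z ⊑ x).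
Proof. by move=> y0; rewrite -(dom_mul2l _ _ y0) [y * (x / y)]mulrC divfK. Qed.

Lemma sdom_divl x y z : y != 0 -> (x / y ⊏ z) = (x ⊏ y * z).
Proof. by move=> y0; rewrite /sdom dom_divr. Qed.

Lemma sdom_divr x y z : y != 0 -> (z ⊏ x / y) = (y * z ⊏ x).
Proof. by move=> y0; rewrite /sdom dom_divl. Qed.

Lemma veq_inv x y : v x = v y -> v x^-1 = v y^-1.
Proof.
move=> xy; case: (eqVneq x 0) (veq_eq0 xy) => [-> /esym/eqP -> //|x0 /esym/negbT y0].
by apply: dom_anti; rewrite -[X in _ ⊑ X]div1r dom_divr // dom_divl ?mulr1 // dom_eq.
Qed.

Lemma veq_div x x' y y' : v x = v x' -> v y = v y' -> v (x / y) = v (x' / y').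
Proof. by move=> xx' yy'; apply: veq_mul => //; apply: veq_inv. Qed.

(** * Polynomials with a distinguished coefficient of least value *)

(** [A] is the Gauss value of [p], and the coefficient of index [h] has that
    value while those on the [r]-side of [h] exceed it: for [r] = [ltn] this
    says that [p / A] reduces to a polynomial of degree [h] over the residue
    field, for [r] = [gtn] that its reduction has order [h] at 0. *)
Definition peak (r : rel nat) (A : F) (h : nat) (p : {poly F}) : Prop :=
  [/\ A != 0, forall i, A ⊑ p`_i, v p`_h = v A &
      forall i, r h i -> A ⊏ p`_i].

(** What a side must satisfy for the leading terms of a product to be the
    product of the leading terms. *)
Definition additive_side (r : rel nat) : Prop :=
  [/\ irreflexive r,
      forall h k i j, r (h + k)%N (i + j)%N -> r h i \/ r k j &
      forall h k i j, (i + j = h + k)%N -> i != h -> r h i \/ r k j].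

Lemma additive_ltn : additive_side ltn.
Proof.
split=> [h|h k i j /= hk|h k i j /= hk ih]; rewrite /= ?ltnn //; case: (ltnP h i) => ?; try by left.
  by right; rewrite ltnNge; apply: contraL hk => jk; rewrite -leqNgt leq_add.
by right; rewrite ltnNge; apply: contra_neqN ih => jk;
  apply/eqP; rewrite eqn_leq; apply/andP; split => //;
  rewrite -(leq_add2r j) hk leq_add2l.
Qed.

Lemma additive_gtn : additive_side gtn.
Proof.
split=> [h|h k i j /= hk|h k i j /= hk ih]; rewrite /= ?ltnn //; case: (ltnP i h) => ?; try by left.
  by right; rewrite ltnNge; apply: contraL hk => jk; rewrite -leqNgt leq_add.
by right; rewrite ltnNge; apply: contra_neqN ih => jk;
  apply/eqP; rewrite eqn_leq; apply/andP; split => //;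
  rewrite -(leq_add2r j) hk leq_add2l.
Qed.

(** The sharp form of Gauss's lemma: the products contributing to the
    coefficient [h + k] are dominated by a single one. *)
Lemma peakM r A B h k p q : additive_side r ->
  peak r A h p -> peak r B k q -> peak r (A * B) (h + k) (p * q).
Proof.
case=> _ side1 side2 [A0 Ap ph rp] [B0 Bq qk rq].
have one i j : (r h i \/ r k j) -> A * B ⊏ p`_i * q`_j.
  by case=> [/rp ? | /rq ?]; [apply: sdom_dom_mul | apply: dom_sdom_mul].
have side i : r (h + k)%N i -> A * B ⊏ (p * q)`_i.
  move=> ri; rewrite coefM; apply: sdom_sum => [|j _]; first exact: mulf_neq0.
  by apply/one/side1; rewrite subnKC // -ltnS ltn_ord.
split=> //; first exact: mulf_neq0.
- by move=> i; rewrite coefM; apply: dom_sum => j _; apply: dom_mul.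
have hlt : (h < (h + k).+1)%N by rewrite ltnS leq_addr.
have e : v (p`_h * q`_k) = v (A * B) by apply: veq_mul.
rewrite coefM (bigD1 (Ordinal hlt)) //= addKn veqDl // (veq_sdom e).
apply: sdom_sum => [|j jh]; first exact: mulf_neq0.
by apply/one/side2 => //; rewrite subnKC // -ltnS ltn_ord.
Qed.

Lemma peak_exists r p : r = ltn \/ r = gtn -> p != 0 -> exists A h, peak r A h p.
Proof.
move=> rE; elim/poly_ind: p => [|p c IHp]; first by rewrite eqxx.
have cE i : (p * 'X + c%:P)`_i = if i == 0%N then c else p`_i.-1.
  by rewrite coefD coefMX coefC; case: i => [|i]; rewrite ?add0r ?addr0.
case: (eqVneq p 0) => [-> | /IHp[A [h [A0 Ap ph rp]]] _].
  rewrite mul0r add0r polyC_eq0 => c0; exists c, 0%N; split=> // [i||i].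
  - by rewrite coefC; case: ifP; rewrite ?dom_refl ?dom_x0.
  - by rewrite coefC.
  - by case: rE => -> //=; rewrite coefC; case: i => [|i] //= _; rewrite sdom_x0.
have [cA|Ac] := boolP (if r 0%N 1%N then c ⊏ A else c ⊑ A).
  have cA' : c ⊑ A by move: cA; case: ifP => // _ /sdomW.
  have c0 : c != 0.
    by apply: contraNneq A0 => c0; rewrite c0 dom_0x in cA'.
  exists c, 0%N; split=> // [i||i]; rewrite cE //.
    by case: ifP => _; [apply: dom_refl | apply: dom_trans cA' (Ap _)].
  by case: rE cA => ->; case: i => // i /= cA _; apply: sdom_dom_trans (Ap _).
have Ac' : A ⊑ c.
  move: Ac; case: ifP => _; rewrite ?sdomNge; last exact: sdomW.
  by rewrite /sdom negbK.
exists A, h.+1; split=> // [i||i]; rewrite cE //; first by case: ifP.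
by case: rE rp Ac => -> rp Ac; case: i => [|i] //=; apply: rp.
Qed.

Lemma peak_prod r (I : eqType) (s : seq I) (A : I -> F) (h : I -> nat)
    (p : I -> {poly F}) : additive_side r ->
  (forall i, i \in s -> peak r (A i) (h i) (p i)) ->
  peak r (\prod_(i <- s) A i) (\sum_(i <- s) h i) (\prod_(i <- s) p i).
Proof.
move=> rs; elim: s => [|i s IHs] pk; last first.
  rewrite !big_cons; apply: peakM => //; first by apply: pk; rewrite mem_head.
  by apply: IHs => j js; apply: pk; rewrite inE js orbT.
have [r00 _ _] := rs.
rewrite !big_nil; split=> [|i||i r0i]; rewrite ?oner_eq0 ?coef1 //.
  by case: eqP; rewrite ?dom_refl ?dom_x0.
by case: eqP r0i => [->|_ _]; rewrite ?r00 // sdom_x0 oner_eq0.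
Qed.

End Dominance.

(** * Polynomials seen from a disc *)

Section Affine.
Variables (F : fieldType) (v : valuation F).
Local Notation "x ⊑ y" := (dom v x y) (at level 70).
Local Notation "x ⊏ y" := (sdom v x y) (at level 70).

Lemma peak_veq r A B h p : v A = v B -> peak v r A h p -> peak v r B h p.
Proof.
move=> AB [A0 Ap ph rp]; split=> [|i||i /rp].
- by rewrite -(veq_eq0 AB).
- by rewrite -(veq_dom AB).
- by rewrite ph.
- by rewrite (veq_sdom AB).
Qed.

Lemma peak_coef r A h p : peak v r A h p -> peak v r p`_h h p.
Proof. by move=> pk; case: (pk) => _ _ /esym ph _; apply: peak_veq ph pk. Qed.

Lemma peakZ r A h p b : additive_side r -> b != 0 ->
  peak v r A h p -> peak v r (b * A) h (b *: p).
Proof.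
move=> rs b0 pk; rewrite -mul_polyC -[h]add0n; apply: peakM pk => //.
case: rs => irr _ _; split=> // [i||i r0i]; rewrite coefC //.
  by case: eqP; rewrite ?dom_refl ?dom_x0.
by case: eqP r0i => [->|_ _]; rewrite ?irr // sdom_x0.
Qed.

(** The polynomial [p] in the coordinate of the disc with centre [c] and
    radius [a]. *)
Definition aff (c a : F) (p : {poly F}) : {poly F} := p \Po (a *: 'X + c%:P).

Lemma horner_aff c a p y : (aff c a p).[y] = p.[a * y + c].
Proof. by rewrite horner_comp !hornerE. Qed.

Lemma aff_coef0 c a p : (aff c a p)`_0 = p.[c].
Proof. by rewrite -horner_coef0 horner_aff mulr0 add0r. Qed.

Lemma aff_deriv c a p : (aff c a p)^`() = a *: aff c a p^`().
Proof.
rewrite /aff deriv_comp derivD derivZ derivX derivC addr0.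
by rewrite -mul_polyC mulr1 mulrC mul_polyC.
Qed.

Lemma size_aff c a p : a != 0 -> size (aff c a p) = size p.
Proof.
move=> a0; apply: size_comp_poly2; rewrite size_polyDl size_scale ?size_polyX //.
by rewrite size_polyC; case: (c == 0).
Qed.

Lemma aff_prod c a (s : seq F) :
  aff c a (\prod_(z <- s) ('X - z%:P)) = \prod_(z <- s) (a *: 'X + (c - z)%:P).
Proof.
rewrite /aff; elim: s => [|z s IHs]; first by rewrite !big_nil comp_polyC.
by rewrite !big_cons comp_polyM IHs comp_polyB comp_polyX comp_polyC polyCB addrA.
Qed.

Lemma lin_coef (a b : F) i :
  (a *: 'X + b%:P)`_i = if i == 0%N then b else if i == 1%N then a else 0.
Proof.
rewrite coefD coefZ coefX coefC; case: i => [|[|i]] /=.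
- by rewrite mulr0 add0r.
- by rewrite mulr1 addr0.
- by rewrite mulr0 addr0.
Qed.

Lemma lin_peak0 r a b : additive_side r -> b ⊏ a -> peak v r b 0 (a *: 'X + b%:P).
Proof.
case=> irr _ _ ba; have b0 := sdom_neq0 ba.
split=> // [i||i r0i]; rewrite lin_coef //.
  by case: i => [|[|i]] /=; rewrite ?dom_refl ?dom_x0 ?(sdomW ba).
by case: i r0i => [|[|i]] /=; rewrite ?irr ?sdom_x0.
Qed.

Lemma lin_peak1_ltn a b : a != 0 -> a ⊑ b -> peak v ltn a 1 (a *: 'X + b%:P).
Proof.
move=> a0 ab; split=> // [i||i r0i]; rewrite lin_coef //.
  by case: i => [|[|i]] /=; rewrite ?dom_refl ?dom_x0.
by case: i r0i => [|[|i]] /=; rewrite ?sdom_x0.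
Qed.

Lemma lin_peak1_gtn a b : a ⊏ b -> peak v gtn a 1 (a *: 'X + b%:P).
Proof.
move=> ab; have a0 := sdom_neq0 ab.
split=> // [i||i r0i]; rewrite lin_coef //.
  by case: i => [|[|i]] /=; rewrite ?dom_refl ?dom_x0 ?(sdomW ab).
by case: i r0i => [|[|i]].
Qed.

Lemma poly_constant_term (p : {poly F}) :
  exists2 s, p = s * 'X + (p`_0)%:P & forall i, s`_i = p`_i.+1.
Proof.
have [s ps] : exists s, p = s * 'X + (p`_0)%:P.
  elim/poly_ind: p => [|q c _]; first by exists 0; rewrite mul0r coef0 polyC0 addr0.
  by exists q; rewrite coefD coefMX coefC add0r.
by exists s => // i; rewrite ps coefD coefMX coefC addr0.
Qed.

(** When the constant term dominates strictly, the value at any integral element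
    is that of the constant term. *)
Lemma peak_horner p y A : peak v ltn A 0 p -> 1 ⊑ y -> v p.[y] = v A.
Proof.
case=> A0 Ap p0 rp y1; have [s ps sE] := poly_constant_term p.
rewrite ps !hornerE addrC veqDl // (veq_sdom p0).
rewrite horner_coef mulr_suml; apply: sdom_sum => // i _.
rewrite -[A]mulr1 -mulrA; apply: sdom_dom_mul; rewrite ?oner_eq0 //.
  by rewrite sE; apply: rp.
by rewrite -exprSr -(expr1n _ i.+1); apply: dom_exp.
Qed.

(** When it merely has least value, this still holds on the maximal ideal. *)
Lemma peak_horner_gtn p y A : peak v gtn A 0 p -> 1 ⊏ y -> v p.[y] = v A.
Proof.
case=> A0 Ap p0 _ y1; have [s ps sE] := poly_constant_term p.
rewrite ps !hornerE addrC veqDl // (veq_sdom p0).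
rewrite horner_coef mulr_suml; apply: sdom_sum => // i _.
rewrite -[A]mulr1 -mulrA; apply: dom_sdom_mul; rewrite ?sE //.
by rewrite -exprSr -(expr1n _ i.+1); apply: sdom_exp.
Qed.

(** Gauss's lemma: the leading terms in the sense of [peak] cannot cancel. *)
Lemma peak_divide p q A h : peak v ltn A h p -> (forall i, A ⊑ (q * p)`_i) ->
  forall i, 1 ⊑ q`_i.
Proof.
move=> pk Aqp i; have [->|q0] := eqVneq q 0; first by rewrite coef0 dom_x0.
have [B [k qk]] := peak_exists v (or_introl (erefl ltn)) q0.
have [_ _ e _] := peakM additive_ltn qk pk.
have := Aqp (k + h)%N; rewrite (veq_dom e) -[X in X ⊑ _]mul1r.
have A0 : A != 0 by case: pk.
rewrite ![_ * A]mulrC dom_mul2l // => B1; apply: dom_trans B1 _.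
by case: qk.
Qed.

End Affine.

Lemma map_aff (K C : fieldType) (j : {rmorphism K -> C}) c a (p : {poly K}) :
  map_poly j (aff c a p) = aff (j c) (j a) (map_poly j p).
Proof. by rewrite /aff map_comp_poly rmorphD /= map_polyZ map_polyX map_polyC. Qed.

Lemma aff0_coef (F : fieldType) (y : F) p i : (aff 0 y p)`_i = p`_i * y ^+ i.
Proof.
rewrite /aff polyC0 addr0 comp_polyE.
under eq_bigr do rewrite exprZn scalerA.
rewrite -(poly_def _ (fun i => p`_i * y ^+ i)) coef_poly; case: ltnP => // pi.
by rewrite nth_default // mul0r.
Qed.

(** * Approximating an element by a subfield *)

Section PureElement.
Variables (K : fieldType) (C : closedFieldType) (j : {rmorphism K -> C}).
Variables (w : valuation C) (t : C).
Local Notation "x ⊑ y" := (dom w x y) (at level 70).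
Local Notation "x ⊏ y" := (sdom w x y) (at level 70).
Local Notation "p ^j" := (map_poly j p) (at level 2, format "p ^j").
Implicit Types (c d : K) (z : C) (s : seq C) (f : {poly K}).

Hypothesis nomax : forall c, exists c', t - j c ⊏ t - j c'.

Definition near (P : K -> Prop) : Prop :=
  exists c0, forall c, t - j c0 ⊑ t - j c -> P c.

Lemma near_all P : (forall c, P c) -> near P.
Proof. by exists 0. Qed.

Lemma near_and P Q : near P -> near Q -> near (fun c => P c /\ Q c).
Proof.
move=> [a Pa] [b Qb]; case/orP: (dom_total w (t - j a) (t - j b)) => ab.
  by exists b => c bc; split; [apply/Pa/(dom_trans ab) | apply: Qb].
by exists a => c ac; split; [apply: Pa | apply/Qb/(dom_trans ab)].
Qed.

Lemma near_imp P Q : (forall c, P c -> Q c) -> near P -> near Q.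
Proof. by move=> PQ [a Pa]; exists a => c /Pa/PQ. Qed.

Lemma near_ex P : near P -> exists c, P c.
Proof. by case=> a Pa; exists a; apply/Pa/dom_refl. Qed.

Lemma near_seq s (P : C -> K -> Prop) : (forall z, z \in s -> near (P z)) ->
  near (fun c => forall z, z \in s -> P z c).
Proof.
elim: s => [|z s IHs] nP; first exact: near_all.
have nz := nP z (mem_head _ _).
have ns : near (fun c => forall z, z \in s -> P z c).
  by apply: IHs => y ys; apply: nP; rewrite inE ys orbT.
apply: near_imp (near_and nz ns) => c [Pz Ps] y; rewrite inE.
by case/orP => [/eqP -> | /Ps].
Qed.

Lemma near_above c0 : near (fun c => t - j c0 ⊏ t - j c).
Proof. by have [c1 c01] := nomax c0; exists c1 => c; apply: sdom_dom_trans. Qed.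

(** The values at elements of [K] of a linear factor do not separate a close
    root [z] from [t]. *)
Definition close z : bool := `[< forall c, t - j c ⊑ t - z >].

Lemma close_lt z c : close z -> t - j c ⊏ t - z.
Proof.
by move/asboolP => cl; have [c' cc'] := nomax c; apply: sdom_dom_trans cc' (cl _).
Qed.

Lemma close_refl : close t.
Proof. by apply/asboolP => c; rewrite subrr dom_x0. Qed.

Lemma t_neq c : t - j c != 0.
Proof. by have [c' /sdom_neq0] := nomax c. Qed.

Lemma close_val z c : close z -> w (j c - z) = w (t - j c).
Proof.
move=> /(close_lt c) cz; rewrite -opprB vN.
have -> : z - j c = (t - j c) - (t - z) by rewrite opprB [RHS]addrC subrKA.
exact: veqBl.
Qed.

Lemma far_near z : ~~ close z -> near (fun c => t - z ⊏ t - j c).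
Proof.
by move=> /asboolPn/existsNP[c0 /negP zc0]; exists c0 => c; apply: sdom_dom_trans zc0.
Qed.

Lemma far_neq0 z : ~~ close z -> t - z != 0.
Proof. by move=> /far_near/near_ex[c /sdom_neq0]. Qed.

Lemma far_val z c : t - z ⊏ t - j c -> w (j c - z) = w (t - z).
Proof.
move=> zc; have -> : j c - z = (t - z) - (t - j c) by rewrite opprB [RHS]addrC subrKA.
exact: veqBl.
Qed.

Lemma far_val_close z z' : close z' -> ~~ close z -> w (z' - z) = w (t - z).
Proof.
move=> cz' /far_near/near_ex[c zc].
have -> : z' - z = (t - z) - (t - z') by rewrite opprB [RHS]addrC subrKA.
by apply: veqBl; apply: sdom_trans zc (close_lt _ cz').
Qed.

Definition farprod s : C := \prod_(z <- s | ~~ close z) (t - z).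

Definition clnum s : nat := count close s.

Lemma farprod_neq0 s : farprod s != 0.
Proof. by rewrite prodf_seq_neq0; apply/allP => z _; apply/implyP/far_neq0. Qed.

Definition far_in s c : Prop := forall z, z \in s -> ~~ close z -> t - z ⊏ t - j c.

Lemma near_far_in s : near (far_in s).
Proof.
apply: (near_seq (P := fun z c => ~~ close z -> t - z ⊏ t - j c)) => z _.
case: (boolP (close z)) => [cz|/far_near]; first exact: near_all.
by apply: near_imp => c.
Qed.

Lemma veq_split s (f : C -> C) (a : C) :
  (forall z, z \in s -> close z -> w (f z) = w a) ->
  (forall z, z \in s -> ~~ close z -> w (f z) = w (t - z)) ->
  w (\prod_(z <- s) f z) = w (a ^+ clnum s * farprod s).
Proof.
rewrite /farprod /clnum; elim: s => [|z s IHs] fc ff.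
  by rewrite !big_nil /= mul1r.
have sub y : y \in s -> y \in z :: s by rewrite inE orbC => ->.
have IH := IHs (fun y ys => fc y (sub y ys)) (fun y ys => ff y (sub y ys)).
rewrite !big_cons /=; case: ifPn => [nz|/negPn cz].
  rewrite (negPf nz) add0n mulrCA; apply: veq_mul => //.
  by apply: ff => //; apply: mem_head.
rewrite cz add1n exprS -mulrA; apply: veq_mul => //.
by apply: fc => //; apply: mem_head.
Qed.

Lemma near_val_prod s :
  near (fun c => w (\prod_(z <- s) (j c - z)) = w ((t - j c) ^+ clnum s * farprod s)).
Proof.
apply: near_imp (near_far_in s) => c sc; apply: veq_split => z zs cz.
  exact: close_val.
exact/far_val/sc.
Qed.

Lemma aff_peak_gen r s c a : additive_side r -> a != 0 -> a ⊑ t - j c ->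
  (forall z, z \in s -> ~~ close z -> t - z ⊏ a) ->
  (forall z, z \in s -> close z -> peak w r a 1 (a *: 'X + (j c - z)%:P)) ->
  peak w r (a ^+ clnum s * farprod s) (clnum s)
    (aff (j c) a (\prod_(z <- s) ('X - z%:P))).
Proof.
move=> rs a0 ac fa cl; rewrite aff_prod.
pose A z := if close z then a else j c - z.
have e : w (\prod_(z <- s) A z) = w (a ^+ clnum s * farprod s).
  apply: veq_split => z zs cz; rewrite /A ?cz // (negPf cz).
  by apply: far_val; apply: sdom_dom_trans ac; apply: fa.
apply: (peak_veq e); rewrite /clnum -sum1_count [X in peak _ _ _ X]big_mkcond /=.
apply: peak_prod => // z zs; rewrite /A; case: ifPn => cz; first exact: cl.
have za := fa z zs cz.
by apply: lin_peak0 => //; rewrite (veq_sdom (far_val (sdom_dom_trans za ac))).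
Qed.

(** A split polynomial on a disc of radius [a] around [c] containing [t] and
    none of the far roots: its reduction has the number of close roots as
    degree; it is a power of [X] when [c] is closer to [t] than the radius. *)
Lemma aff_peak_ltn s c a : a != 0 -> a ⊑ t - j c ->
  (forall z, z \in s -> ~~ close z -> t - z ⊏ a) ->
  peak w ltn (a ^+ clnum s * farprod s) (clnum s)
    (aff (j c) a (\prod_(z <- s) ('X - z%:P))).
Proof.
move=> a0 ac fa; apply: aff_peak_gen => //; first exact: additive_ltn.
move=> z zs cz; apply: lin_peak1_ltn => //.
by rewrite (veq_dom (close_val c cz)).
Qed.

Lemma aff_peak_gtn s c a : a ⊏ t - j c ->
  (forall z, z \in s -> ~~ close z -> t - z ⊏ a) ->
  peak w gtn (a ^+ clnum s * farprod s) (clnum s)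
    (aff (j c) a (\prod_(z <- s) ('X - z%:P))).
Proof.
move=> ac fa; have a0 := sdom_neq0 ac.
apply: aff_peak_gen => //; [exact: additive_gtn | exact: sdomW |].
move=> z zs cz; apply: lin_peak1_gtn.
by rewrite (veq_sdom (close_val c cz)).
Qed.

(** * Polynomials of small degree have only far roots *)

Variable n : nat.
Hypothesis pure : forall f : {poly K}, (size f <= n)%N ->
  exists c, forall b, t - j c ⊑ t - j b -> w (j f.[b]) = w (j f.[c]).

Lemma not_fixed h A : A != 0 -> (0 < h)%N -> forall (F : K -> C) c0,
  (forall b, t - j c0 ⊑ t - j b -> w (F b) = w (F c0)) ->
  ~ near (fun c => w (F c) = w ((t - j c) ^+ h * A)).
Proof.
case: h => // h A0 _ f c0 fc0 nf.
have [c [c0c fc]] := near_ex (near_and (near_above c0) nf).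
have [b [cb fb]] := near_ex (near_and (near_above c) nf).
have : w ((t - j c) ^+ h.+1 * A) = w ((t - j b) ^+ h.+1 * A).
  by rewrite -fc -fb !fc0 // sdomW // (sdom_trans c0c).
move=> e; have := sdom_exp h cb.
by rewrite -(sdom_mul2l _ _ _ A0) mulrC (veq_sdom e) mulrC sdom_irr.
Qed.

Lemma map_poly_split f : f != 0 ->
  exists l s, l != 0 /\ f^j = l *: \prod_(z <- s) ('X - z%:P).
Proof.
move=> f0; have [s fs] := closed_field_poly_normal f^j.
by exists (lead_coef f^j), s; rewrite lead_coef_eq0 map_poly_eq0.
Qed.

Lemma pure_far f z : f != 0 -> (size f <= n)%N -> root f^j z -> ~~ close z.
Proof.
move=> f0 fn rz; have [l [s [lc0 fs]]] := map_poly_split f0.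
have zs : z \in s by move: rz; rewrite fs rootZ // root_prod_XsubC.
apply/negP => cz; have [c0 fc0] := pure fn.
have h0 : (0 < clnum s)%N by rewrite -has_count; apply/hasP; exists z.
apply: (@not_fixed (clnum s) (l * farprod s)) h0 _ _ fc0 _.
  by rewrite mulf_neq0 ?farprod_neq0.
apply: near_imp (near_val_prod s) => c e.
rewrite -horner_map fs hornerZ mulrCA; apply: veq_mul => //.
rewrite horner_prod -e; congr (vfun w _); apply: eq_bigr => y _.
by rewrite !hornerE.
Qed.

Lemma pure_val_close f z : (size f <= n)%N -> close z -> w f^j.[z] = w f^j.[t].
Proof.
move=> fn cz; have [->|f0] := eqVneq f 0; first by rewrite rmorph0 !horner0.
have [l [s [lc0 fs]]] := map_poly_split f0.
rewrite fs !hornerZ; apply: veq_mul => //; rewrite !horner_prod big_seq [in RHS]big_seq.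
apply: veq_prod => y ys; rewrite !hornerE; apply: far_val_close => //.
by apply: pure_far f0 fn _; rewrite fs rootZ // root_prod_XsubC.
Qed.

(** On a small disc around [t] the constant term dominates a polynomial of
    small degree. *)
Lemma pure_peak f : f != 0 -> (size f <= n)%N ->
  near (fun c => forall a, w a = w (t - j c) ->
    peak w ltn f^j.[j c] 0 (aff (j c) a f^j)).
Proof.
move=> f0 fn; have [l [s [lc0 fs]]] := map_poly_split f0.
have h0 : clnum s = 0%N.
  apply/eqP; rewrite eqn0Ngt -has_count; apply/hasPn => z zs.
  by apply: pure_far f0 fn _; rewrite fs rootZ // root_prod_XsubC.
apply: near_imp (near_far_in s) => c sc a ac.
rewrite -(aff_coef0 _ a); apply: (@peak_coef _ _ _ (l * (a ^+ clnum s * farprod s))).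
rewrite fs /aff comp_polyZ -/(aff _ _ _); apply: peakZ => //.
  exact: additive_ltn.
rewrite -h0.
apply: aff_peak_ltn.
- by rewrite (veq_eq0 ac) t_neq.
- by rewrite (veq_dom ac) dom_refl.
- by move=> z zs cz; rewrite (veq_sdom ac); apply: sc.
Qed.

Lemma pure_val f : (size f <= n)%N -> near (fun c => w f^j.[t] = w f^j.[j c]).
Proof.
move=> fn; have [->|f0] := eqVneq f 0.
  by apply: near_all => c; rewrite rmorph0 !horner0.
apply: near_imp (pure_peak f0 fn) => c /(_ _ (erefl _)) pk.
have y1 : dom w 1 1 by apply: dom_refl.
by rewrite -(peak_horner pk y1) horner_aff mulr1 subrK.
Qed.

End PureElement.

(** A Padé form: [P * u] has no terms in the [N] degrees above [h]. The [N]
    equations leave a solution among the [N.+1] coefficients of [u]. *)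
Lemma pade (K : fieldType) (P : {poly K}) (h N : nat) :
  exists u : {poly K}, [/\ u != 0, (size u <= N.+1)%N &
    forall i, (h < i <= h + N)%N -> (P * u)`_i = 0].
Proof.
pose A : 'M[K]_(N.+1, N) := \matrix_(i, k) (P * 'X^i)`_(h + k).+1.
have : kermx A != 0.
  rewrite kermx_eq0 /row_free; apply/eqP => rA.
  by have := rank_leq_col A; rewrite rA ltnn.
case/rowV0Pn => v /sub_kermxP vA v0.
exists (\poly_(i < N.+1) v 0 (inord i)); split=> [||i /andP[hi iN]].
- apply: contra_neq v0 => e; apply/rowP => i; rewrite mxE.
  by have /polyP/(_ i) := e; rewrite coef_poly ltn_ord inord_val coef0.
- exact: size_poly.
have lt : (i - h.+1 < N)%N by rewrite ltn_subLR // addSn ltnS.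
have /matrixP/(_ 0 (Ordinal lt)) := vA; rewrite !mxE => e.
rewrite -[RHS]e poly_def mulr_sumr coef_sum; apply: eq_bigr => k _.
by rewrite -scalerAr coefZ !mxE inord_val -addSn subnKC.
Qed.

Section Growth.
Variables (K : fieldType) (C : closedFieldType) (j : {rmorphism K -> C}).
Variables (w : valuation C) (t : C).
Local Notation "x ⊑ y" := (dom w x y) (at level 70).
Local Notation "x ⊏ y" := (sdom w x y) (at level 70).
Local Notation "p ^j" := (map_poly j p) (at level 2, format "p ^j").
Implicit Types (c d : K) (z : C) (s : seq C) (f : {poly K}).

Hypothesis nomax : forall c, exists c', t - j c ⊏ t - j c'.
Hypothesis scale : forall c, exists a, w (j a) = w (t - j c).

Variable n : nat.
Hypothesis pure : forall f : {poly K}, (size f <= n)%N ->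
  exists c, forall b, t - j c ⊑ t - j b -> w (j f.[b]) = w (j f.[c]).

Variables (g : {poly K}) (gs : seq C).
Hypothesis g_split : g^j = \prod_(z <- gs) ('X - z%:P).
Hypothesis g_root : root g^j t.

Local Notation near := (near j w t).
Local Notation close := (close j w t).
Local Notation h := (clnum j w t gs).
Local Notation D := (farprod j w t gs).
Local Notation far_in := (far_in j w t gs).

Lemma t_root : t \in gs.
Proof. by rewrite -root_prod_XsubC -g_split. Qed.

Lemma clnum_gt0 : (0 < h)%N.
Proof. by rewrite -has_count; apply/hasP; exists t; [apply: t_root | apply: close_refl]. Qed.

Lemma g_peak_ltn c a : a != 0 -> j a ⊑ t - j c ->
    (forall z, z \in gs -> ~~ close z -> t - z ⊏ j a) ->
  peak w ltn (j a ^+ h * D) h (aff c a g)^j.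
Proof.
by move=> a0 ac fa; rewrite map_aff g_split; apply: aff_peak_ltn; rewrite ?fmorph_eq0.
Qed.

Lemma g_peak_gtn c a : j a ⊏ t - j c ->
    (forall z, z \in gs -> ~~ close z -> t - z ⊏ j a) ->
  peak w gtn (j a ^+ h * D) h (aff c a g)^j.
Proof. by move=> ac fa; rewrite map_aff g_split; apply: aff_peak_gtn. Qed.

Lemma g_val c : far_in c -> w g^j.[j c] = w ((t - j c) ^+ h * D).
Proof.
move=> fc; rewrite g_split horner_prod.
rewrite -(@veq_split _ _ _ _ _ gs (fun z => j c - z)).
- by congr (vfun w _); apply: eq_bigr => z _; rewrite !hornerE.
- by move=> z _ cz; apply: close_val.
- by move=> z zs cz; apply/far_val/fc.
Qed.

(** If only some of the roots of [g] are close to [t], the distances from [t]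
    to [K] are cofinal in a coset of a convex subgroup: if they stopped short
    of the [M]-th multiple of a step, a Padé approximant of order [M] of the
    factor of [g] with the close roots would be a polynomial over [K] of degree
    less than [n] whose values near [t] are not eventually constant. *)
Lemma distances_cofinal c0 c1 M : (h < n)%N ->
    far_in c0 -> t - j c0 ⊏ t - j c1 ->
  exists2 c, t - j c1 ⊏ t - j c &
    ((t - j c1) / (t - j c0)) ^+ M ⊑ ((t - j c) / (t - j c0)) ^+ h.
Proof.
move=> hn fc0 c01; have [a ac] := scale c0.
have t0 : t - j c0 != 0 by apply: t_neq nomax _.
have ja0 : j a != 0 by rewrite (veq_eq0 ac).
have a0 : a != 0 by rewrite -(fmorph_eq0 j).
apply: contrapT => noc.
have Plt : peak w ltn (j a ^+ h * D) h (aff c1 a g)^j.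
  apply: g_peak_ltn => //; first by rewrite (veq_dom ac) sdomW.
  by move=> z zs cz; rewrite (veq_sdom ac); apply: fc0.
have Pgt : peak w gtn (j a ^+ h * D) h (aff c1 a g)^j.
  apply: g_peak_gtn; first by rewrite (veq_sdom ac).
  by move=> z zs cz; rewrite (veq_sdom ac); apply: fc0.
set P := aff c1 a g in Plt Pgt; set E := j a ^+ h * D in Plt Pgt.
have [u [u0 su uP]] := pade P h M.
have uj0 : u^j != 0 by rewrite map_poly_eq0.
have [B [k uk]] := peak_exists w (or_intror (erefl gtn)) uj0.
have Pu := peakM (@additive_gtn) Pgt uk.
have kM : (k <= M)%N.
  rewrite -ltnS; apply: leq_trans su; rewrite ltnNge -(size_map_poly j).
  apply: contraTN isT => /(nth_default 0) e.
  by case: uk => B0 _ /veq_eq0; rewrite e eqxx (negPf B0).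
have k0 : k = 0%N.
  (* otherwise the coefficient of [P * u] of least value is one of those that vanish *)
  apply/eqP; rewrite -leqn0 leqNgt; apply/negP => k0.
  case: Pu => EB0 _ + _; rewrite -rmorphM coef_map uP.
    by rewrite raddf0 => /veq_eq0; rewrite eqxx (negPf EB0).
  by rewrite leq_add2l kM -addn1 leq_add2l k0.
rewrite {}k0 in uk Pu.
(* the terms of degree at most [h], in the original coordinate *)
pose f := aff (- (c1 / a)) a^-1 (take_poly h.+1 (P * u)).
have sf : (size f <= n)%N.
  by rewrite size_aff ?invr_eq0 //; apply: leq_trans (size_take_poly _ _) hn.
have [c2 fc2] := pure sf.
have DB0 : D * B != 0 by case: uk => B0 _ _ _; rewrite mulf_neq0 ?farprod_neq0.
apply: (@not_fixed _ _ _ _ _ nomax h (D * B) DB0 clnum_gt0 (fun c => j f.[c]) c2).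
  exact: fc2.
apply: near_imp (near_above nomax c1) => c c1c.
pose y := (j c - j c1) / j a.
have vy : w y = w ((t - j c1) / (t - j c0)).
  apply: veq_div => //; have -> : j c - j c1 = (t - j c1) - (t - j c).
    by rewrite opprB [RHS]addrC subrKA.
  exact: veqBl.
have y1 : 1 ⊏ y by rewrite (veq_sdom vy) sdom_divr // mulr1.
have fc : far_in c.
  move=> z zs cz; apply: sdom_trans c1c; apply: sdom_trans c01; exact: fc0.
have Puy : w (P * u)^j.[y] = w ((t - j c) ^+ h * (D * B)).
  rewrite rmorphM hornerM mulrA; apply: veq_mul; last exact: peak_horner_gtn uk y1.
  rewrite -(g_val fc) /P /= map_aff horner_aff; congr (vfun w _.[_]).
  by rewrite mulrC divfK // subrK.
pose r := drop_poly h.+1 (P * u).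
have fE : j f.[c] = (P * u)^j.[y] - r^j.[y] * y ^+ h.+1.
  rewrite -[in (P * u)^j](poly_take_drop h.+1 (P * u)) rmorphD rmorphM /= map_polyXn.
  rewrite !hornerE addrK -horner_map map_aff horner_aff; congr (_.[_]).
  by rewrite rmorphN rmorphM /= fmorphV [_^-1 * _]mulrC -mulrBl.
rewrite fE veqBl // (veq_sdom Puy).
have step : (t - j c) ^+ h * (D * B) ⊏ E * B * y ^+ M.
  have vE : w (E * B * y ^+ M) =
      w (D * B * ((t - j c0) ^+ h * ((t - j c1) / (t - j c0)) ^+ M)).
    rewrite /E [_ * D]mulrC [_ * B]mulrAC -[_ * _ * y ^+ M]mulrA; apply: veq_mul => //.
    by apply: veq_mul; apply: veq_exp.
  rewrite (veq_sdom vE) mulrC sdom_mul2l //.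
  rewrite -sdom_divl ?expf_neq0 // -expr_div_n.
  by apply/negP => bad; apply: noc; exists c.
apply: sdom_dom_trans step _.
have [EB0 EBle _ _] := Pu.
rewrite horner_coef mulr_suml; apply: dom_sum => i _.
rewrite -[_ * y ^+ h.+1]mulrA coef_map coef_drop_poly; have [iM|Mi] := ltnP i M.
  rewrite uP ?raddf0 ?mul0r ?dom_x0 //; apply/andP; split.
    by rewrite addnS ltnS leq_addl.
  by rewrite addnS addnC -addnS leq_add2l.
apply: dom_mul; first by have := EBle (i + h.+1)%N; rewrite -rmorphM coef_map.
rewrite -exprD -(subnKC (leq_trans Mi (leq_addr h.+1 i))) exprD -[X in X ⊑ _]mulr1.
apply: dom_mul (dom_refl _ _) _; rewrite -(expr1n _ (i + h.+1 - M)%N).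
by apply: dom_exp; apply: sdomW.
Qed.

(** * The different of [g] at [t] *)

Definition closeprod s : C := \prod_(z <- s | close z) (t - z).

Lemma horner_deriv_root :
  g^`()^j.[t] = closeprod (rem t gs) * D.
Proof.
have gE : g^j = ('X - t%:P) * \prod_(z <- rem t gs) ('X - z%:P).
  by rewrite g_split (perm_big _ (perm_to_rem t_root)) big_cons.
rewrite -deriv_map gE derivM derivXsubC mul1r !hornerE subrr mul0r addr0.
rewrite horner_prod (bigID close) /closeprod /farprod /=.
rewrite [in RHS](perm_big _ (perm_to_rem t_root)) big_cons /= close_refl /=.
by congr (_ * _); apply: eq_bigr => z _; rewrite !hornerE.
Qed.

Lemma clnum_rem : (clnum j w t (rem t gs)).+1 = h.
Proof.
rewrite /clnum (permP (perm_to_rem t_root)) /=.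
by rewrite close_refl.
Qed.

Lemma deriv_val_simple : h = 1%N -> g^`()^j.[t] = D.
Proof.
rewrite -clnum_rem horner_deriv_root => -[r0]; rewrite /closeprod big_seq_cond big1 ?mul1r //.
move=> z /andP[zs cz]; suff : (0 < clnum j w t (rem t gs))%N by rewrite r0.
by rewrite -has_count; apply/hasP; exists z.
Qed.

Lemma closeprod_ge s (a : K) : (t - j a) ^+ clnum j w t s ⊑ closeprod s.
Proof.
rewrite /closeprod /clnum; elim: s => [|z s IHs]; first by rewrite big_nil dom_refl.
rewrite big_cons /=; case: ifP => //= cz; rewrite add1n exprS.
by apply: dom_mul => //; apply/sdomW/close_lt.
Qed.

Lemma closeprod_gt s (a b : K) k : clnum j w t s = k.+1 ->
  (t - j b) * (t - j a) ^+ k ⊏ closeprod s.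
Proof.
elim: s => [|z s IHs] //=; rewrite /closeprod big_cons /clnum /=.
case: ifP => cz; last by rewrite add0n => /IHs.
rewrite add1n => -[<-]; apply: sdom_dom_mul.
- by rewrite expf_neq0 // (t_neq nomax).
- exact: close_lt.
- exact: closeprod_ge.
Qed.

(** With several close roots, but not only close roots, the different at [t]
    stays strictly above the Gauss values of [g] on small discs, up to a fixed
    factor: each difference with another close root exceeds all the distances
    from [t] to [K], hence, by [distances_cofinal], also the [h]-th multiple of
    any one of them relative to [c0]. *)
Lemma deriv_gt : (1 < h)%N -> (h < n)%N -> exists2 c0, far_in c0 &
  forall c, t - j c0 ⊑ t - j c -> (t - j c) ^+ h * D ⊏ (t - j c0) * g^`()^j.[t].
Proof.
move=> h1 hn; have [c0 fc0] := near_ex (near_far_in j w t gs).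
exists c0 => // c c0c.
have [c1 [c01 cc1]] := near_ex (near_and (near_above nomax c0) (near_above nomax c)).
have t0 : t - j c0 != 0 by apply: t_neq nomax _.
(* one factor [h] compensates the exponent on the other side of the bound, the
   other one is the exponent wanted here *)
have [c2 _] := distances_cofinal (h * h) hn fc0 c01.
have [k hk] : exists k, h = k.+2 by case: h h1 => [|[|k]] //; exists k.
have exp2 x y : x ^+ h ⊑ y ^+ h -> x ⊑ y by rewrite hk; apply: dom_exp2r.
move=> /[!exprM]/exp2; rewrite expr_div_n dom_divl ?expf_neq0 //.
have -> : (t - j c0) ^+ h * ((t - j c2) / (t - j c0)) =
    (t - j c0) * ((t - j c2) * (t - j c0) ^+ k).
  by rewrite hk mulrC exprS -mulrA mulKf // exprS mulrCA.
move=> step; rewrite horner_deriv_root mulrA ![_ * D]mulrC.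
rewrite sdom_mul2l ?farprod_neq0 //.
apply: (@dom_sdom_trans _ _ ((t - j c1) ^+ h)); first by apply/dom_exp/sdomW.
apply: dom_sdom_trans step _; rewrite sdom_mul2l //.
by apply: closeprod_gt; move: clnum_rem; rewrite hk => -[].
Qed.

(** * Integral polynomials *)

Lemma horner_integral (p : {poly C}) y : (forall i, 1 ⊑ p`_i) -> 1 ⊑ y -> 1 ⊑ p.[y].
Proof.
move=> p1 y1; rewrite horner_coef; apply: dom_sum => i _.
rewrite -[1]mulr1; apply: dom_mul => //; rewrite -(expr1n _ i); exact: dom_exp.
Qed.

Lemma pure_integral f : (size f <= n)%N -> 1 ⊑ f^j.[t] ->
  near (fun c => forall a, w a = w (t - j c) -> forall i, 1 ⊑ (aff (j c) a f^j)`_i).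
Proof.
move=> fn f1; have [->|f0] := eqVneq f 0.
  by apply: near_all => c a _ i; rewrite rmorph0 /aff comp_poly0 coef0 dom_x0.
apply: near_imp (near_and (pure_peak nomax pure f0 fn) (pure_val nomax pure fn)).
move=> c [pk ft] a ac i; rewrite (veq_dom ft) in f1.
by have [_ + _ _] := pk a ac => /(_ i); apply: dom_trans.
Qed.

(** By Gauss's lemma, reducing modulo [g] a product of elements of the
    valuation ring costs a multiple of [g] that is bounded by the inverse of
    the Gauss value of [g] on small discs. *)
Lemma quotient_bound (f1 f2 q r : {poly K}) :
    (size f1 <= n)%N -> (size f2 <= n)%N -> (size r <= n)%N ->
    1 ⊑ f1^j.[t] -> 1 ⊑ f2^j.[t] -> 1 ⊑ r^j.[t] -> f1 * f2 = q * g + r ->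
  near (fun c => 1 ⊑ q^j.[t] * ((t - j c) ^+ h * D)).
Proof.
move=> s1 s2 sr f1t f2t rt e.
have := near_and (near_far_in j w t gs) (near_and (pure_integral sr rt)
   (near_and (pure_integral s1 f1t) (pure_integral s2 f2t))).
apply: near_imp => c [fc [ir [i1 i2]]]; have [a ac] := scale c.
have a0 : j a != 0 by rewrite (veq_eq0 ac) (t_neq nomax).
have pk : peak w ltn (j a ^+ h * D) h (aff c a g)^j.
  apply: g_peak_ltn; rewrite ?(veq_dom ac) ?dom_refl //.
    by rewrite -(fmorph_eq0 j).
  by move=> z zs cz; rewrite (veq_sdom ac); apply: fc.
have vE : w (j a ^+ h * D) = w ((t - j c) ^+ h * D).
  by apply: veq_mul => //; apply: veq_exp.
have E0 : j a ^+ h * D != 0 by case: pk.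
pose y := (t - j c) / j a.
have y1 : 1 ⊑ y by rewrite dom_divr // mulr1 dom_eq.
have -> : (1 ⊑ q^j.[t] * ((t - j c) ^+ h * D)) = (1 ⊑ (j a ^+ h * D) * q^j.[t]).
  by rewrite mulrC; apply: (veq_dom _).2; apply: veq_mul.
have := @horner_integral ((j a ^+ h * D) *: aff (j c) (j a) q^j) y.
rewrite hornerZ horner_aff /y [j a * _]mulrC divfK // subrK.
apply=> //; apply: (peak_divide pk) => i.
rewrite map_aff -scalerAl coefZ -[X in X ⊑ _]mulr1 dom_mul2l // -comp_polyM.
have -> : q^j * g^j = f1^j * f2^j - r^j by rewrite -!rmorphM e rmorphD /= addrK.
rewrite comp_polyB comp_polyM coefB; apply: dom_B; last exact: ir.
rewrite coefM; apply: dom_sum => k _; rewrite -[1]mulr1.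
by apply: dom_mul; [apply: i1 | apply: i2].
Qed.

End Growth.

(** * Newton polygons *)

(** The values of the coefficients determine those of the roots: [y] has
    the value of some root of [p'] precisely when the least value among the
    [p'`_i * y ^+ i] is attained twice. *)
Lemma newton_root (C : closedFieldType) (w : valuation C) (p p' : {poly C}) y :
    p != 0 -> (forall i, w p`_i = w p'`_i) -> root p y ->
  exists2 z, root p' z & w z = w y.
Proof.
move=> p0 pp' ry; have p'0 : p' != 0.
  apply: contra_neq p0 => e; apply/polyP => i; apply/eqP.
  by rewrite coef0 (veq_eq0 (pp' i)) e coef0.
have [y0|y0] := eqVneq y 0.
  exists 0; rewrite ?y0 // /root horner_coef0 -(veq_eq0 (pp' 0%N)).
  by move: ry; rewrite /root y0 horner_coef0.
have [s ps] := closed_field_poly_normal p'; set l := lead_coef p' in ps.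
have l0 : l != 0 by rewrite lead_coef_eq0.
apply: contrapT => noz.
have sy z : z \in s -> w z <> w y.
  by move=> zs zy; apply: noz; exists z => //; rewrite ps rootZ // root_prod_XsubC.
(* the factor [y X - z] of [p' (y X)] has a single coefficient of least value *)
pose A z := if sdom w z y then 0 - z else y.
pose h z : nat := ~~ sdom w z y.
have pk r : r = ltn \/ r = gtn ->
    peak w r (l * \prod_(z <- s) A z) (\sum_(z <- s) h z) (aff 0 y p').
  move=> rE; have rs : additive_side r.
    by case: rE => ->; [apply: additive_ltn | apply: additive_gtn].
  rewrite ps /aff comp_polyZ -/(aff 0 y _) aff_prod; apply: peakZ => //.
  apply: peak_prod => // z zs; rewrite /A /h; case: (boolP (sdom w z y)) => zy.
    by apply: lin_peak0; rewrite // sub0r /sdom dom_N.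
  have {}zy : sdom w y (0 - z).
    rewrite sub0r sdom_N; apply/negP => zy'; apply: (sy z zs); apply: dom_anti => //.
    by move: zy; rewrite /sdom negbK.
  by case: rE => ->; [apply: lin_peak1_ltn; rewrite ?sdomW | apply: lin_peak1_gtn].
have [B0 _ vk Blt] := pk _ (or_introl (erefl _)).
have [_ _ _ Bgt] := pk _ (or_intror (erefl _)).
move: (l * _) B0 vk Blt Bgt => B B0; move: (\sum_(z <- s) h z)%N => k vk Blt Bgt.
have e i : w (p`_i * y ^+ i) = w (aff 0 y p')`_i.
  by rewrite aff0_coef; apply: veq_mul.
have kp : (k < size p)%N.
  rewrite ltnNge; apply: contraNN B0 => /(nth_default 0) pk0.
  by rewrite -(veq_eq0 vk) -(veq_eq0 (e k)) pk0 mul0r.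
move: ry; rewrite /root horner_coef (bigD1 (Ordinal kp)) //=.
rewrite (@veq_eq0 _ w _ (p`_k * y ^+ k)) ?(veq_eq0 (e k)) ?(veq_eq0 vk) ?(negPf B0) //.
apply: veqDl; have ek := etrans (e k) vk; rewrite (veq_sdom ek).
apply: sdom_sum => // i ik; rewrite (veq_sdom (e i)).
case: (ltngtP i k) => [|| ik']; [exact: Bgt | exact: Blt |].
by case/eqP: ik; apply: val_inj.
Qed.

(** * Prolonging valued correspondences *)

(** The graph of an isomorphism between subfields that preserves the
    valuation; it is a graph because [w] takes the value infinity only at 0.
    Being symmetric in both subfields, this notion treats injectivity and
    surjectivity at once. *)
Record valued_corr (C : fieldType) (w : valuation C) (G : C -> C -> Prop) : Prop :=
  ValuedCorr {
    corr1 : G 1 1;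
    corrB : forall a a' b b', G a a' -> G b b' -> G (a - b) (a' - b');
    corrM : forall a a' b b', G a a' -> G b b' -> G (a * b) (a' * b');
    corrV : forall a a', G a a' -> G a^-1 a'^-1;
    corr_val : forall a a', G a a' -> w a = w a'
  }.

Section Correspondence.
Variables (C : closedFieldType) (w : valuation C) (G : C -> C -> Prop).
Hypothesis HG : valued_corr w G.

Lemma corr0 : G 0 0.
Proof. by have := corrB HG (corr1 HG) (corr1 HG); rewrite subrr. Qed.

Lemma corrN a a' : G a a' -> G (- a) (- a').
Proof. by move=> aa'; have := corrB HG corr0 aa'; rewrite !sub0r. Qed.

Lemma corrD a a' b b' : G a a' -> G b b' -> G (a + b) (a' + b').
Proof. by move=> aa' /corrN /(corrB HG aa'); rewrite !opprK. Qed.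

Lemma corr_sum (I : Type) (r : seq I) (P : pred I) (f f' : I -> C) :
  (forall i, P i -> G (f i) (f' i)) ->
  G (\sum_(i <- r | P i) f i) (\sum_(i <- r | P i) f' i).
Proof.
by move=> ff'; apply: (big_ind2 G) => //; [apply: corr0 | move=> *; apply: corrD].
Qed.

Lemma corr_fun a b b' : G a b -> G a b' -> b = b'.
Proof.
move=> /(corrB HG) ab /ab /(corr_val HG) e; apply/eqP; rewrite -subr_eq0.
by rewrite -(veq_eq0 e) subrr.
Qed.

Definition pcorr (p p' : {poly C}) : Prop := forall i, G p`_i p'`_i.

Lemma pcorr_eq0 p p' : pcorr p p' -> p = 0 -> p' = 0.
Proof.
move=> pp' p0; apply/polyP => i; rewrite coef0; apply/eqP.
by rewrite -(veq_eq0 (corr_val HG (pp' i))) p0 coef0.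
Qed.

Lemma pcorr_size p p' : pcorr p p' -> size p = size p'.
Proof.
move=> pp'; have z i : (p`_i == 0) = (p'`_i == 0) by apply: veq_eq0 (corr_val HG (pp' i)).
apply/eqP; rewrite eqn_leq; apply/andP; split; apply/leq_sizeP => i /(nth_default 0)/eqP.
  by rewrite -z => /eqP.
by rewrite z => /eqP.
Qed.

Lemma pcorrC a a' : G a a' -> pcorr a%:P a'%:P.
Proof. by move=> aa' i; rewrite !coefC; case: eqP => // _; apply: corr0. Qed.

Lemma pcorrX : pcorr 'X 'X.
Proof. by move=> i; rewrite coefX; case: eqP => _; [exact: corr1 HG | exact: corr0]. Qed.

Lemma pcorrN p p' : pcorr p p' -> pcorr (- p) (- p').
Proof. by move=> pp' i; rewrite !coefN; apply: corrN. Qed.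

Lemma pcorrD p p' q q' : pcorr p p' -> pcorr q q' -> pcorr (p + q) (p' + q').
Proof. by move=> pp' qq' i; rewrite !coefD; apply: corrD. Qed.

Lemma pcorrB p p' q q' : pcorr p p' -> pcorr q q' -> pcorr (p - q) (p' - q').
Proof. by move=> pp' /pcorrN; apply: pcorrD. Qed.

Lemma pcorrM p p' q q' : pcorr p p' -> pcorr q q' -> pcorr (p * q) (p' * q').
Proof.
by move=> pp' qq' i; rewrite !coefM; apply: corr_sum => k _; exact: (corrM HG (pp' _) (qq' _)).
Qed.

Lemma pcorrXn n : pcorr 'X^n 'X^n.
Proof.
elim: n => [|n IHn]; first by apply: pcorrC (corr1 HG).
by rewrite exprS; apply: pcorrM IHn; apply: pcorrX.
Qed.

Lemma pcorr_exp p p' n : pcorr p p' -> pcorr (p ^+ n) (p' ^+ n).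
Proof.
move=> pp'; elim: n => [|n IHn]; first by rewrite !expr0; apply: pcorrC (corr1 HG).
by rewrite !exprS; apply: pcorrM.
Qed.

Lemma pcorr_char_poly d (M M' : 'M[C]_d) :
  (forall i k, G (M i k) (M' i k)) -> pcorr (char_poly M) (char_poly M').
Proof.
have p1 : pcorr 1 1 by apply: pcorrC (corr1 HG).
move=> MM'; rewrite /char_poly /determinant.
apply: (big_ind2 pcorr); [exact: pcorrC corr0 | by move=> *; apply: pcorrD |].
move=> s _; apply: pcorrM.
  by apply: pcorr_exp; apply: pcorrN.
apply: (big_ind2 pcorr) => // [* | i _]; first exact: pcorrM.
rewrite !mxE; apply: pcorrB; last exact: pcorrC.
by case: eqP => _; [apply: pcorrX | apply: (pcorrC corr0)].
Qed.

Section Extend.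
Variables (x : C) (m m' : {poly C}).
Hypotheses (mm' : pcorr m m') (m_monic : m \is monic) (mx : root m x).
Hypothesis m_min :
  forall p p', pcorr p p' -> root p x -> p != 0 -> (size m <= size p)%N.

Lemma m'_monic : m' \is monic.
Proof.
rewrite monicE /lead_coef -(pcorr_size mm'); apply/eqP.
apply: (@corr_fun 1); last exact: corr1 HG.
by have := mm' (size m).-1; rewrite -/(lead_coef m) (monicP m_monic).
Qed.

Lemma m_gt1 : (1 < size m)%N.
Proof. exact: root_size_gt1 (monic_neq0 m_monic) mx. Qed.

Lemma pcorr_divide p p' : pcorr p p' -> exists q q' r r',
  [/\ pcorr q q', pcorr r r', p = q * m + r, p' = q' * m' + r' &
      (size r < size m)%N].
Proof.
have [k] := ubnP (size p); elim: k p p' => // k IHk p p'; rewrite ltnS => pk pp'.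
have [pm|mp] := ltnP (size p) (size m).
  exists 0, 0, p, p'; split; rewrite ?mul0r ?add0r //; exact: pcorrC corr0.
pose b : {poly C} := (lead_coef p)%:P * 'X^(size p - size m).
pose b' : {poly C} := (p'`_(size p).-1)%:P * 'X^(size p - size m).
have bb' : pcorr b b'.
  by apply: pcorrM; [apply/pcorrC/pp' | apply: pcorrXn].
have lt : (size (p - b * m)%R < size p)%N.
  have p0 : (0 < size p)%N by apply: leq_trans mp; apply: ltnW m_gt1.
  rewrite -(prednK p0) ltnS; apply/leq_sizeP => i; rewrite leq_eqVlt => /orP[/eqP<-|].
    rewrite coefB /b -mulrA coefCM coefXnM.
    have sE : ((size p).-1 - (size p - size m) = (size m).-1)%N.
      by rewrite -subn1 subnAC subKn // subn1.
    rewrite ifF ?sE; first by rewrite -/(lead_coef m) (monicP m_monic) mulr1 subrr.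
    apply/negbTE; rewrite -leqNgt -(leq_add2r (size m)) subnK // -ltnS.
    by rewrite -addSn prednK // -[X in (X < _)%N]addn0 ltn_add2l ltnW // m_gt1.
  rewrite prednK // => pi; rewrite coefB /b -mulrA coefCM coefXnM.
  rewrite nth_default // sub0r ifF; last first.
    by apply/negbTE; rewrite -leqNgt; apply: leq_trans pi; apply: leq_subr.
  by rewrite nth_default ?mulr0 ?oppr0 // leq_subRL ?subnK // (leq_trans _ pi) ?leq_subr.
have [q [q' [r [r' [qq' rr' e e' sr]]]]] :=
  IHk _ _ (leq_trans lt pk) (pcorrB pp' (pcorrM bb' mm')).
exists (q + b), (q' + b'), r, r'; split=> //; first exact: pcorrD.
  by rewrite mulrDl addrAC -e subrK.
by rewrite mulrDl addrAC -e' subrK.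
Qed.

Lemma pcorr_root p p' z : pcorr p p' -> root p x -> root m' z -> root p' z.
Proof.
move=> /pcorr_divide[q [q' [r [r' [qq' rr' -> -> sr]]]]] px m'z.
have r0 : r = 0.
  apply: contraTeq sr => r0; rewrite -leqNgt; apply: m_min rr' _ r0.
  by move: px; rewrite /root !hornerE (eqP mx) mulr0 add0r.
by rewrite (pcorr_eq0 rr' r0) addr0 rootM m'z orbT.
Qed.

(** The eigenvalues of multiplication by [q] modulo [m] are the values of [q]
    at the roots of [m]; its characteristic polynomial has coefficients in the
    domain of the correspondence, so Newton polygons apply. *)
Lemma conjugate_value q q' : pcorr q q' ->
  exists2 z, root m' z & w q'.[z] = w q.[x].
Proof.
move=> qq'; pose d := (size m).-1.
have dm : d.+1 = size m by rewrite prednK // ltnW ?m_gt1.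
have divX (i : 'I_d) := pcorr_divide (pcorrM qq' (pcorrXn i)).
have [s /(_ _)/cid-/all_sig[s' /(_ _)/cid-/all_sig[r]]] := all_sig (fun i => cid (divX i)).
move=> /(_ _)/cid-/all_sig[r' H].
pose M : 'M[C]_d := \matrix_(i, k) (r i)`_k.
pose M' : 'M[C]_d := \matrix_(i, k) (r' i)`_k.
have rootM : root (char_poly M) q.[x].
  have -> : char_poly M = char_poly M^T.
    by rewrite /char_poly -det_tr; congr (\det _); apply/matrixP => i k; rewrite !mxE eq_sym.
  rewrite -eigenvalue_root_char; apply/eigenvalueP.
  exists (\row_(k < d) x ^+ k).
    apply/rowP => i; rewrite !mxE; under eq_bigr do rewrite !mxE mulrC.
    have [_ _ e _ sr] := H i.
    rewrite -horner_coef_wide; last by rewrite -ltnS dm.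
    have := congr1 (horner^~ x) e; rewrite !hornerE (eqP mx) mulr0 add0r => ->.
    by [].
  have d0 : (0 < d)%N by rewrite -ltnS dm m_gt1.
  apply/eqP => /rowP/(_ (Ordinal d0)); rewrite !mxE expr0 => /eqP.
  by rewrite oner_eq0.
have cc : pcorr (char_poly M) (char_poly M').
  by apply: pcorr_char_poly => i k; rewrite !mxE; have [_ rr' _ _ _] := H i.
have [y' + yq] := newton_root (monic_neq0 (char_poly_monic M)) (fun i => corr_val HG (cc i)) rootM.
rewrite -eigenvalue_root_char => /eigenvalueP[v vM v0].
have [|] := boolP (coprimep m' (q' - y'%:P)); last first.
  rewrite coprimep_def => /closed_rootP[z]; rewrite root_gcd => /andP[mz].
  by rewrite /root !hornerE subr_eq0 => /eqP qz; exists z; rewrite ?qz.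
pose V := rVpoly v.
have sV : (size V <= d)%N by apply: size_poly.
have VE : V = \sum_i v 0 i *: 'X^i.
  rewrite /V [in LHS](row_sum_delta v) linear_sum; apply: eq_bigr => i _.
  by rewrite linearZ /= rVpoly_delta.
have rV : \sum_i v 0 i *: r' i = y' *: V.
  rewrite /V -linearZ -vM mulmx_sum_row linear_sum; apply: eq_bigr => i _.
  rewrite linearZ_LR; congr (_ *: _); have [_ rr' _ _ sr] := H i.
  rewrite -[LHS](@poly_rV_K _ d) -?(pcorr_size rr') -1?ltnS ?dm //.
  by congr rVpoly; apply/rowP => k; rewrite !mxE.
move=> cop; case/eqP: v0.
have : m' %| (q' - y'%:P) * V.
  have -> : (q' - y'%:P) * V = (\sum_i v 0 i *: s' i) * m'; last exact: dvdp_mulIr.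
  rewrite mulrBl mul_polyC -rV VE mulr_sumr mulr_suml -sumrB; apply: eq_bigr => i _.
  have [_ _ _ e _] := H i.
  by rewrite -scalerAr -scalerAl -scalerBr e addrK.
rewrite Gauss_dvdpr // => /dvdp_leq; have [V0 _|V0 /(_ isT)] := eqVneq V 0.
  by rewrite -[v]rVpolyK -/V V0 linear0.
by rewrite -(pcorr_size mm') -dm ltnNge sV.
Qed.

(** A single root works for all [q] at once: if each root were excluded by some
    [q], a monomial in these [q] would exclude all roots, since for each root
    two distinct exponents cannot both fail. *)
Lemma conjugate_root : exists2 z, root m' z &
  forall q q', pcorr q q' -> w q.[x] = w q'.[z].
Proof.
apply: contrapT => noz.
have bad z : root m' z -> exists q q',
    [/\ pcorr q q', q.[x] != 0 & w q'.[z] <> w q.[x]].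
  move=> mz; apply: contrapT => nobad; apply: noz; exists z => // q q' qq'.
  have [qx|qx] := eqVneq q.[x] 0.
    by have /rootP -> := pcorr_root qq' (introT rootP qx) mz; rewrite qx.
  by apply: contrapT => ne; apply: nobad; exists q, q'; split=> // /esym.
have [s m's] := closed_field_poly_normal m'.
have rs z : (z \in s) = root m' z.
  by rewrite m's rootZ ?root_prod_XsubC // lead_coef_eq0 monic_neq0 ?m'_monic.
have [q [q' [qq' qx qs]]] : exists q q',
    [/\ pcorr q q', q.[x] != 0 & forall z, z \in s -> w q'.[z] <> w q.[x]].
  have : {subset s <= root m'} by move=> z; rewrite rs.
  elim: (s) => [|z r IHr] sub.
    by exists 1, 1; split; [exact: pcorrC (corr1 HG) | rewrite hornerC oner_eq0 |].
  have [q [q' [qq' qx qr]]] := IHr (fun y yr => sub y (mem_behead (s := z :: r) yr)).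
  have [e [e' [ee' ex ez]]] := bad z (sub z (mem_head _ _)).
  (* dividing one equality by the other removes [e] *)
  have once y N k : w (q'.[y] ^+ N * e'.[y]) = w (q.[x] ^+ N * e.[x]) ->
      w (q'.[y] ^+ (k.+1 + N) * e'.[y]) = w (q.[x] ^+ (k.+1 + N) * e.[x]) ->
      w q'.[y] = w q.[x].
    move=> E1; rewrite !exprD -!mulrA (veq_mul (erefl (w (q'.[y] ^+ k.+1))) E1).
    move/veq_mulIf => E2; apply: (@veq_exp2r _ _ _ _ k); apply: E2.
    by rewrite mulf_neq0 ?expf_neq0.
  have ev y : y \in z :: r -> exists N0, forall N, (N0 <= N)%N ->
      w (q'.[y] ^+ N * e'.[y]) <> w (q.[x] ^+ N * e.[x]).
    move=> yzr; have [eqy|ney] := pselect (w q'.[y] = w q.[x]).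
      exists 0%N => N _; move: yzr; rewrite inE => /orP[/eqP yz|/qr //].
      rewrite (veq_mul (veq_exp N eqy) (erefl _)) ![q.[x] ^+ N * _]mulrC => /veq_mulIf h.
      by apply: ez; rewrite -yz; apply: h; rewrite expf_neq0.
    have [[N bN]|nob] := pselect (exists N,
        w (q'.[y] ^+ N * e'.[y]) = w (q.[x] ^+ N * e.[x])); last first.
      by exists 0%N => N _ bN; apply: nob; exists N.
    exists N.+1 => N' lt bN'; apply: ney; apply: (once y N (N' - N.+1)%N) => //.
    by rewrite addSnnS subnK.
  have [N evN] : exists N, forall y, y \in z :: r ->
      w (q'.[y] ^+ N * e'.[y]) <> w (q.[x] ^+ N * e.[x]).
    suff [N0 h] : exists N0, forall y, y \in z :: r -> forall N, (N0 <= N)%N ->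
        w (q'.[y] ^+ N * e'.[y]) <> w (q.[x] ^+ N * e.[x]).
      by exists N0 => y yzr; apply: h.
    elim: (z :: r) ev => [|y l IHl] ev; first by exists 0%N.
    have [N1 h1] := ev y (mem_head _ _).
    have [N2 h2] := IHl (fun u ul => ev u (mem_behead (s := y :: l) ul)).
    exists (maxn N1 N2) => u + N; rewrite geq_max inE => /orP[/eqP->|ul] /andP[l1 l2].
      exact: h1.
    exact: h2.
  exists (q ^+ N * e), (q' ^+ N * e'); split.
  - by apply: pcorrM => //; apply: pcorr_exp.
  - by rewrite hornerM horner_exp mulf_neq0 ?expf_neq0.
  - by move=> y yzr; rewrite !hornerM !horner_exp; apply: evN.
have [z mz] := conjugate_value qq'; apply: qs; by rewrite rs.
Qed.

End Extend.

(** The prolongation to the field generated by [x] sends [x] to the conjugate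
    found in [conjugate_root]; fractions of polynomials are used so as to get a
    field at once. *)
Lemma corr_extend x : (exists p p', [/\ pcorr p p', p != 0 & root p x]) ->
  exists x' G', [/\ valued_corr w G', forall a b, G a b -> G' a b & G' x x'].
Proof.
move=> [p0 [p0' [pp0 p00 px0]]].
pose P n := `[< exists p p', [/\ pcorr p p', p != 0, root p x & size p = n] >].
have exP : exists n, P n.
  by exists (size p0); apply/asboolP; exists p0, p0'.
case: (ex_minnP exP) => n /asboolP[p [p' [pp' pn0 px sp]]] minn.
pose l := lead_coef p; have l0 : l != 0 by rewrite lead_coef_eq0.
pose m := l^-1%:P * p; pose m' := (p'`_(size p).-1)^-1%:P * p'.
have mm' : pcorr m m' by apply: pcorrM => //; apply/pcorrC/(corrV HG)/pp'.
have mm : m \is monic by rewrite monicE /m lead_coefM lead_coefC mulVf.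
have mx : root m x by rewrite rootM px orbT.
have m_min q q' : pcorr q q' -> root q x -> q != 0 -> (size m <= size q)%N.
  move=> qq' qx q0; rewrite /m mul_polyC size_scale ?invr_eq0 // sp.
  by apply: minn; apply/asboolP; exists q, q'.
have [z mz Hz] := conjugate_root mm' mm mx m_min.
pose G' a b := exists p p' q q', [/\ pcorr p p', pcorr q q', q.[x] != 0,
  a = p.[x] / q.[x] & b = p'.[z] / q'.[z]].
have nz q q' : pcorr q q' -> q.[x] != 0 -> q'.[z] != 0.
  by move=> /Hz e; rewrite (veq_eq0 e).
have c1 : pcorr 1 1 by apply: pcorrC (corr1 HG).
have inc q q' : pcorr q q' -> G' q.[x] q'.[z].
  by move=> qq'; exists q, q', 1, 1; split; rewrite // !hornerC ?oner_eq0 // divr1.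
exists z, G'; split.
- split.
  + by have := inc _ _ c1; rewrite !hornerC.
  + move=> _ _ _ _ [p1 [p1' [q1 [q1' [P1 Q1 n1 -> ->]]]]] [p2 [p2' [q2 [q2' [P2 Q2 n2 -> ->]]]]].
    exists (p1 * q2 - p2 * q1), (p1' * q2' - p2' * q1'), (q1 * q2), (q1' * q2').
    have n1' := nz _ _ Q1 n1; have n2' := nz _ _ Q2 n2.
    split; rewrite ?hornerM ?mulf_neq0 //; first by apply: pcorrB; apply: pcorrM.
    * exact: pcorrM.
    * by rewrite !hornerE -mulNr addf_div // mulNr.
    * by rewrite !hornerE -mulNr addf_div // mulNr.
  + move=> _ _ _ _ [p1 [p1' [q1 [q1' [P1 Q1 n1 -> ->]]]]] [p2 [p2' [q2 [q2' [P2 Q2 n2 -> ->]]]]].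
    exists (p1 * p2), (p1' * p2'), (q1 * q2), (q1' * q2').
    split; rewrite ?hornerM ?mulf_neq0 ?mulf_div //; exact: pcorrM.
  + move=> _ _ [p1 [p1' [q1 [q1' [P1 Q1 n1 -> ->]]]]].
    have [p10|p10] := eqVneq p1.[x] 0.
      have p1z : p1'.[z] = 0 by apply/eqP; rewrite -(veq_eq0 (Hz _ _ P1)) p10.
      rewrite p10 p1z !mul0r invr0.
      by have := inc _ _ (pcorrC corr0); rewrite !hornerC.
    by exists q1, q1', p1, p1'; split; rewrite ?invf_div.
  + move=> _ _ [p1 [p1' [q1 [q1' [P1 Q1 n1 -> ->]]]]].
    by apply: veq_div; apply: Hz.
- by move=> a b ab; have := inc _ _ (pcorrC ab); rewrite !hornerC.
- by have := inc _ _ pcorrX; rewrite !hornerX.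
Qed.

End Correspondence.

Lemma corr_flip (C : fieldType) (w : valuation C) G :
  valued_corr w G -> valued_corr w (fun a b => G b a).
Proof.
case=> c1 cB cM cV cw; split=> // [a a' b b'|a a' b b'|a a'|a a' /cw //];
  [exact: cB | exact: cM | exact: cV].
Qed.

(** Every correspondence whose domain contains a subfield over which everything
    is algebraic prolongs to an automorphism: a maximal prolongation is total
    and, being maximal for its flip too, onto. *)
Theorem corr_automorphism (K : fieldType) (C : closedFieldType)
    (j : {rmorphism K -> C}) (w : valuation C) (G0 : C -> C -> Prop) :
    (forall x, algebraicOver j x) -> valued_corr w G0 -> (forall a, G0 (j a) (j a)) ->
  exists s : {rmorphism C -> C},
    [/\ bijective s, forall y, w (s y) = w y & forall a b, G0 a b -> s a = b].
Proof.
move=> alg H0 jG0.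
(* the empty set is included as an upper bound of the empty chain *)
pose P (A : set (C * C)) := A = set0 \/
  (valued_corr w (fun a b => A (a, b)) /\ (forall a b, G0 a b -> A (a, b))).
have [F FP Ftot|A [PA Amax]] := @Zorn_bigcup _ P.
  have [F0|/existsNP[A0 /not_implyP[FA0 A00]]] := pselect (forall A, F A -> A = set0).
    by left; apply/seteqP; split=> // u [A FA Au]; rewrite -(F0 A FA).
  have good A u : F A -> A u -> valued_corr w (fun a b => A (a, b)) /\
      (forall a b, G0 a b -> A (a, b)).
    by move=> FA Au; case: (FP A FA) => // AE; rewrite AE in Au.
  have /set0P[u0 A0u] : A0 != set0 by apply/eqP.
  have [V0 I0] := good _ _ FA0 A0u.
  have two a b : (\bigcup_(X in F) X)%classic a -> (\bigcup_(X in F) X)%classic b ->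
      exists A, [/\ F A, A a & A b].
    move=> [A FA Aa] [B FB Bb]; case: (Ftot A B FA FB) => AB.
      by exists B; split=> //; apply: AB.
    by exists A; split=> //; apply: AB.
  right; split; last by move=> a b ab; exists A0 => //; apply: I0.
  split.
  - by exists A0 => //; apply: corr1 V0.
  - move=> a a' b b' /two h /h[A [FA Aa Ab]]; exists A => //.
    by have [V _] := good _ _ FA Aa; apply: (corrB V).
  - move=> a a' b b' /two h /h[A [FA Aa Ab]]; exists A => //.
    by have [V _] := good _ _ FA Aa; apply: (corrM V).
  - move=> a a' [A FA Aa]; exists A => //.
    by have [V _] := good _ _ FA Aa; apply: (corrV V).
  - move=> a a' [A FA Aa].
    by have [V _] := good _ _ FA Aa; apply: (corr_val V).
have [V I] : valued_corr w (fun a b => A (a, b)) /\ (forall a b, G0 a b -> A (a, b)).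
  case: PA => // A0; exfalso.
  apply: (Amax [set u : C * C | G0 u.1 u.2]%classic); last by right; split.
  rewrite A0; split=> [|h]; first by move=> u [].
  by have := h (1, 1) (corr1 H0).
have max G' : valued_corr w G' -> (forall a b, A (a, b) -> G' a b) ->
    forall a b, G' a b -> A (a, b).
  move=> V' I' a b G'ab; apply: contrapT => nA.
  apply: (Amax [set u : C * C | G' u.1 u.2]%classic).
    by split=> [[u u'] /I' //|h]; apply: nA; apply: (h (a, b)).
  by right; split=> // c d /I /I'.
have algA (G : C -> C -> Prop) : valued_corr w G -> (forall a, G (j a) (j a)) -> forall x,
    exists p p', [/\ pcorr G p p', p != 0 & root p x].
  move=> VG jG x; have [p p0 px] := alg x.
  exists (map_poly j p), (map_poly j p); split; rewrite ?map_poly_eq0 //.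
  by move=> i; rewrite coef_map; apply: jG.
have tot x : exists x', A (x, x').
  have [x' [G' [V' I' xx']]] := corr_extend V (algA _ V (fun a => I _ _ (jG0 a)) x).
  by exists x'; apply: max V' I' _ _ xx'.
have onto x' : exists x, A (x, x').
  have [x [G' [V' I' xx']]] :=
    corr_extend (corr_flip V) (algA _ (corr_flip V) (fun a => I _ _ (jG0 a)) x').
  exists x; apply: (max (fun a b => G' b a)) xx' => //; first exact: corr_flip.
  by move=> a b; apply: I'.
pose s0 x := sval (cid (tot x)).
have As x : A (x, s0 x) by rewrite /s0; case: cid.
have sE a b : A (a, b) -> s0 a = b by apply: (corr_fun V); apply: As.
have s_zmod : zmod_morphism s0 by move=> a b; apply/sE/(corrB V).
have s_monoid : monoid_morphism s0.
  by split=> [|a b]; [apply/sE/(corr1 V) | apply/sE/(corrM V)].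
pose s : {rmorphism C -> C} := HB.pack s0
  (GRing.isZmodMorphism.Build C C s0 s_zmod) (GRing.isMonoidMorphism.Build C C s0 s_monoid).
exists s; split=> [|y|a b /I /sE //]; last exact/esym/(corr_val V)/As.
pose r x' := sval (cid (onto x')).
have Ar x' : A (r x', x') by rewrite /r; case: cid.
exists r => x; last exact/sE/Ar.
exact/esym/(corr_fun (corr_flip V) (As x) (Ar (s x))).
Qed.

(** * Kähler differentials *)

Lemma derivation_horner (A B : comNzRingType) (f : {rmorphism A -> B})
    (M : lmodType B) (D : B -> M) : is_derivation f D ->
  forall (p : {poly A}) y, D (map_poly f p).[y] = (map_poly f p^`()).[y] *: D y.
Proof.
case=> DD DM DA p y; elim/poly_ind: p => [|p c IHp].
  by rewrite deriv0 !rmorph0 !horner0 scale0r -(rmorph0 f) DA.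
rewrite derivMXaddC !rmorphD !rmorphM /= map_polyX map_polyC !hornerE.
rewrite DD DA addr0 DM IHp scalerDl scalerA [y * _]mulrC; by [].
Qed.

Lemma fglift_linear (B : comNzRingType) (M : lmodType B) (D : B -> M) :
  linear (fglift D : {freeg B / B} -> M).
Proof.
pose g := fglift D : {freeg B / B} -> M.
have gB u x : g (u - x) = g u - g x by exact: lift_is_additive.
have g0 : g 0 = 0 by rewrite -(subrr 0) gB subrr.
have gD u x : g (u + x) = g u + g x.
  by rewrite -[x in LHS]opprK gB -[- x]sub0r gB g0 sub0r opprK.
move=> k u x; rewrite -[LHS]/(g _) gD; congr (_ + _).
suff /asboolP : u \in (fun u => `[< forall k, g (k *: u) = k *: g u >]) by apply.
apply: freeg_span => [|b]; first split=> [|a y z].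
- by apply/asboolP => l; rewrite scaler0 g0 scaler0.
- move=> /asboolP gy /asboolP gz; apply/asboolP => l.
  by rewrite scalerDr scalerA !gD !gy gz scalerDr scalerA.
apply/asboolP => l; have unit k' : g << k' *g b >> = k' *: D b by apply: liftU.
rewrite unit scale1r -unit; apply: (congr1 g).
by apply/eqP/freeg_eqP => y; rewrite coeffZ !coeffU mul1r.
Qed.

Lemma kaehler_eq0 (A B : comNzRingType) (f : {rmorphism A -> B}) :
  (forall b, kaehler_d f b = 0) -> forall x : kaehler f, x = 0.
Proof.
move=> d0 x; rewrite -[x]kaehler_class_repr.
apply/eqP; rewrite kaehler_class_eq0; apply: freeg_span; first exact: kaehler_sub_closed.
by move=> b; rewrite -kaehler_class_eq0; apply/eqP/d0.
Qed.

(** A criterion for a differential not to vanish that avoids constructing a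
    quotient module: [J] is the submodule by which it would be divided. *)
Lemma kaehler_d_neq0 (A B : comNzRingType) (f : {rmorphism A -> B})
    (M : lmodType B) (D : B -> M) (J : M -> Prop) (b0 : B) :
    J 0 -> (forall a x y, J x -> J y -> J (a *: x + y)) ->
    (forall b c, J (D (b + c) - D b - D c)) ->
    (forall b c, J (D (b * c) - b *: D c - c *: D b)) ->
    (forall a, J (D (f a))) -> ~ J (D b0) ->
  kaehler_d f b0 <> 0.
Proof.
move=> J0 Jlin JD JM JA nJ /eqP; rewrite kaehler_class_eq0 => /asboolP.
have lin := fglift_linear D.
have gU b : fglift D << b >> = D b by rewrite liftU scale1r.
have gB u x : fglift D (u - x) = fglift D u - fglift D x.
  exact: lift_is_additive.
move=> /(_ (fun u => `[< J (fglift D u) >])) h; apply: nJ; rewrite -gU.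
apply/asboolP; apply: h => [|_ [b c|b c|a]]; last by apply/asboolP; rewrite gU.
- split=> [|a x y].
    by apply/asboolP; rewrite -(subrr 0) gB subrr.
  by move=> /asboolP Jx /asboolP Jy; apply/asboolP; rewrite lin; apply: Jlin.
- by apply/asboolP; rewrite !gB !gU.
apply/asboolP; rewrite !gB !gU.
have gZ k u : fglift D (k *: u) = k *: fglift D u.
  by rewrite -[k *: u]addr0 lin -(subrr 0) gB subrr addr0.
by rewrite !gZ !gU.
Qed.

Section ScalarRestriction.
Variables (B : pzRingType) (C : comNzRingType) (f : {rmorphism B -> C}).

(** The morphism is a parameter of the type, so that the module structure over
    [B] can be inferred from the type. *)
Definition restricted of {rmorphism B -> C} : Type := C.
HB.instance Definition _ := GRing.Zmodule.on (restricted f).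
Definition restricted_scale (b : B) (x : restricted f) : restricted f := f b * (x : C).
Fact restricted_scaleA a b x :
  restricted_scale a (restricted_scale b x) = restricted_scale (a * b) x.
Proof. by rewrite /restricted_scale rmorphM mulrA. Qed.
Fact restricted_scale1 : left_id 1 restricted_scale.
Proof. by move=> x; rewrite /restricted_scale rmorph1 mul1r. Qed.
Fact restricted_scaleDr : right_distributive restricted_scale +%R.
Proof. by move=> a x y; apply: mulrDr. Qed.
Fact restricted_scaleDl x : {morph restricted_scale^~ x : a b / a + b}.
Proof. by move=> a b; rewrite /restricted_scale rmorphD mulrDl. Qed.
HB.instance Definition _ := GRing.Zmodule_isLmodule.Build B (restricted f)
  restricted_scaleA restricted_scale1 restricted_scaleDr restricted_scaleDl.
End ScalarRestriction.

Lemma lift_poly (F : fieldType) (v : valuation F) (p : {poly F}) :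
  (forall i, valring_pred v p`_i) -> exists p' : {poly valring v}, map_poly val p' = p.
Proof.
move=> vp; exists (\poly_(i < size p) (ValRing (vp i))).
apply/polyP => i; rewrite coef_map coef_poly; case: ltnP => //= pi.
by rewrite nth_default.
Qed.

Section Omega.
Variables (K : fieldType) (L : fieldExtType K) (v : valuation L).
Variables (C : closedFieldType) (iota : {rmorphism L -> C}) (w : valuation C).
Hypothesis w_ext : vequiv (vrestr iota w) v.
Local Notation j := (iota \o in_alg L).
Local Notation "x ⊑ y" := (dom w x y) (at level 70).
Local Notation "x ⊏ y" := (sdom w x y) (at level 70).
Local Notation "p ^j" := (map_poly j p) (at level 2, format "p ^j").

Lemma dom_ext x y : dom v x y = (iota x ⊑ iota y).
Proof. by rewrite /dom -w_ext. Qed.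

Lemma valring_ext x : valring_pred v x = (1 ⊑ iota x).
Proof. by rewrite -(rmorph1 iota) -dom_ext /dom v1. Qed.

Lemma valring_base a : valring_pred (vbase v) a = (1 ⊑ j a).
Proof. exact: valring_ext. Qed.

Variable eta : L.
Local Notation t := (iota eta).
Hypothesis nomax : forall c, exists c', t - j c ⊏ t - j c'.
Hypothesis scale : forall c, exists a, w (j a) = w (t - j c).
Variable n : nat.
Hypothesis pure : forall f : {poly K}, (size f <= n)%N ->
  exists c, forall b, t - j c ⊑ t - j b -> w (j f.[b]) = w (j f.[c]).
Variables (g : {poly K}) (gs : seq C).
Hypothesis g_split : g^j = \prod_(z <- gs) ('X - z%:P).
Hypothesis g_root : root g^j t.
Hypothesis gen : forall z : L, exists2 f : {poly K}, (size f <= n)%N & iota z = f^j.[t].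
Hypothesis indep : forall f : {poly K}, (size f <= n)%N -> f^j.[t] = 0 -> f = 0.
Hypothesis g_min : forall f : {poly K}, root f^j t -> exists q, f = q * g.

Local Notation h := (clnum j w t gs).
Local Notation D := (farprod j w t gs).
Local Notation near := (near j w t).

Lemma coordinate c a : w (j a) = w (t - j c) -> valring_pred v ((eta - c%:A) / a%:A).
Proof.
move=> ac; rewrite valring_ext fmorph_div rmorphB /=.
have a0 : j a != 0 by rewrite (veq_eq0 ac) (t_neq nomax).
by rewrite dom_divr // mulr1 dom_eq.
Qed.

Lemma iota_coordinate c a : iota ((eta - c%:A) / a%:A) = (t - j c) / j a.
Proof. by rewrite fmorph_div rmorphB. Qed.

Lemma horner_coordinate (p : {poly K}) (p' : {poly valring (vbase v)}) c a
    (ac : w (j a) = w (t - j c)) : map_poly val p' = aff c a p ->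
  iota (val (map_poly (valring_map (in_alg L) v) p').[ValRing (coordinate ac)]) = p^j.[t].
Proof.
move=> e; rewrite -!horner_map /=.
have -> : map_poly iota (map_poly val (map_poly (valring_map (in_alg L) v) p')) =
    (aff c a p)^j by rewrite -e; apply/polyP => i; rewrite !coef_map.
rewrite map_aff horner_aff iota_coordinate mulrC divfK ?subrK //.
by rewrite (veq_eq0 ac) (t_neq nomax).
Qed.

Theorem Omega_zero : h = 1%N -> forall x : Omega v, x = 0.
Proof.
move=> h1; apply: kaehler_eq0 => b.
have dd := kaehler_d_derivation (valring_map (in_alg L) v).
have [f fn bf] := gen (val b).
have f1 : 1 ⊑ f^j.[t] by rewrite -bf -valring_ext valringP.
have [c [fc ic]] := near_ex (near_and (near_far_in j w t gs)
   (pure_integral nomax pure fn f1)).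
have [a ac] := scale c.
have a0 : j a != 0 by rewrite (veq_eq0 ac) (t_neq nomax).
have [f' f'E] : exists f' : {poly valring (vbase v)}, map_poly val f' = aff c a f.
  apply: lift_poly => i; rewrite valring_base.
  by have := ic (j a) ac i; rewrite -map_aff coef_map.
have pk : peak w ltn (j a ^+ h * D) h (aff c a g)^j.
  apply: g_peak_ltn; rewrite ?(veq_dom ac) ?dom_refl //.
    by rewrite -(fmorph_eq0 j).
  by move=> z zs cz; rewrite (veq_sdom ac); apply: fc.
(* [e] is a Gauss value of [g] on the disc that lies in [K] *)
rewrite h1 expr1 in pk; pose e := (aff c a g)`_1.
have je : w (j e) = w (j a * D) by case: pk => _ _ + _; rewrite coef_map.
have e0 : j e != 0 by rewrite (veq_eq0 je); case: pk.
have [P PE] : exists P : {poly valring (vbase v)}, map_poly val P = aff c a (e^-1 *: g).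
  apply: lift_poly => i; rewrite valring_base /aff comp_polyZ coefZ rmorphM fmorphV mulrC.
  rewrite dom_divr // mulr1 (veq_dom je); case: pk => _ /(_ i) + _ _.
  by rewrite coef_map.
pose Y := ValRing (coordinate ac).
have PY : (map_poly (valring_map (in_alg L) v) P).[Y] = 0.
  apply/val_inj/(fmorph_inj iota); rewrite (horner_coordinate _ PE) rmorph0.
  by rewrite map_polyZ hornerZ (rootP g_root) mulr0.
have P'E : map_poly val P^`() = aff c a (a *: (e^-1 *: g^`())).
  rewrite -deriv_map PE aff_deriv derivZ /aff.
  by rewrite !comp_polyZ.
have P'Y : w (iota (val (map_poly (valring_map (in_alg L) v) P^`()).[Y])) = w 1.
  rewrite (horner_coordinate _ P'E) !map_polyZ !hornerZ.
  rewrite (deriv_val_simple g_split g_root h1) fmorphV mulrCA mulrC.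
  by rewrite -(divff e0); apply: veq_div.
have Y0 : kaehler_d (valring_map (in_alg L) v) Y = 0.
  have := derivation_horner dd P Y; rewrite PY.
  have [_ _ dA] := dd; rewrite -(rmorph0 (valring_map (in_alg L) v)) dA.
  set u := (_).[Y] in P'Y *; move=> /esym uY.
  have u0 : iota (val u) != 0 by rewrite (veq_eq0 P'Y) oner_eq0.
  have vu : valring_pred v (val u)^-1.
    by rewrite valring_ext fmorphV -div1r dom_divr // mulr1 dom_eq.
  have uV : ValRing vu * u = 1.
    by apply/val_inj; rewrite /= mulVf // -(fmorph_eq0 iota).
  by rewrite -[LHS]scale1r -uV -scalerA uY scaler0.
have -> : b = (map_poly (valring_map (in_alg L) v) f').[Y].
  by apply/val_inj/(fmorph_inj iota); rewrite (horner_coordinate _ f'E).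
by rewrite (derivation_horner dd) Y0 scaler0.
Qed.

Theorem Omega_nonzero : (1 < h)%N -> (h < n)%N -> ~ forall x : Omega v, x = 0.
Proof.
move=> h1 hn O0; have [c0 fc0 dgt] := deriv_gt nomax scale pure g_split g_root h1 hn.
have [a0 ac0] := scale c0.
have ja0 : j a0 != 0 by rewrite (veq_eq0 ac0) (t_neq nomax).
pose mu c := (t - j c) ^+ h * D.
(* the values allowed by [quotient_bound] on some disc *)
pose J (z : C) := exists2 c, t - j c0 ⊑ t - j c & g^`()^j.[t] ⊑ z * mu c.
pose rep (b : valring v) := s2val (cid2 (gen (val b))).
have rep_size b : (size (rep b) <= n)%N by rewrite /rep; case: cid2.
have repE b : iota (val b) = (rep b)^j.[t] by rewrite /rep; case: cid2.
have rep_uniq b (f : {poly K}) : (size f <= n)%N -> iota (val b) = f^j.[t] -> rep b = f.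
  move=> sf e; apply/eqP; rewrite -subr_eq0; apply/eqP/indep.
    by rewrite (leq_trans (size_polyD _ _)) // size_polyN geq_max rep_size.
  by rewrite rmorphB hornerD hornerN -repE e subrr.
pose emb : {rmorphism valring v -> C} := iota \o val.
pose D0 (b : valring v) : restricted emb := (rep b)^`()^j.[t].
have JN z : J z -> J (- z) by case=> c cc e; exists c => //; rewrite mulNr dom_N.
have J0 : J 0 by exists c0; rewrite ?dom_refl // mul0r dom_x0.
apply: (@kaehler_d_neq0 _ _ (valring_map (in_alg L) v) _ D0 J
          (ValRing (coordinate ac0))) => //.
- move=> a x y [c1 cc1 e1] [c2 cc2 e2].
  have mono z c c' : t - j c ⊑ t - j c' -> z * mu c ⊑ z * mu c'.
    by move=> cc'; apply: dom_mul (dom_refl _ _) (dom_mul (dom_exp _ cc') (dom_refl _ _)).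
  have Ja : J (emb a * x).
    exists c1 => //; apply: dom_trans e1 _; rewrite -mulrA -[X in X ⊑ _]mul1r.
    by apply: dom_mul (dom_refl _ _); rewrite -valring_ext valringP.
  case: Ja => c3 cc3 e3; rewrite -[a *: x]/(emb a * x).
  case/orP: (dom_total w (t - j c2) (t - j c3)) => cc.
    exists c3 => //; rewrite mulrDl; apply: dom_D e3 _.
    exact: dom_trans e2 (mono _ _ _ cc).
  exists c2 => //; rewrite mulrDl; apply: dom_D _ e2.
  exact: dom_trans e3 (mono _ _ _ cc).
- move=> b c; suff -> : D0 (b + c) - D0 b - D0 c = 0 by [].
  rewrite /D0 (rep_uniq (b + c) (rep b + rep c)).
  + by rewrite derivD rmorphD hornerD addrAC addrK subrr.
  + by rewrite (leq_trans (size_polyD _ _)) // geq_max !rep_size.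
  + by rewrite /= rmorphD !repE rmorphD hornerD.
- move=> b c; have [q qE] : exists q, rep b * rep c - rep (b * c) = q * g.
    apply: g_min; rewrite /root rmorphB rmorphM /= hornerD hornerN hornerM -!repE.
    by rewrite /= rmorphM subrr.
  have qE' : rep b * rep c = q * g + rep (b * c) by rewrite -qE subrK.
  have i1 x : 1 ⊑ (rep x)^j.[t] by rewrite -repE -valring_ext valringP.
  have nq := quotient_bound nomax scale pure g_split (rep_size b) (rep_size c)
    (rep_size _) (i1 b) (i1 c) (i1 _) qE'.
  have [c1 [q1 cc1]] := near_ex (near_and nq (near_above nomax c0)).
  have -> : D0 (b * c) - b *: D0 c - c *: D0 b = - (q^j.[t] * g^`()^j.[t]).
    rewrite -![_ *: _]/(emb _ * _) /D0 /= !repE.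
    have := congr1 (fun p => p^`()^j.[t]) qE'.
    rewrite !derivD !derivM !rmorphD !rmorphM /= !hornerE (rootP g_root) mulr0 add0r.
    have tr (x1 x2 y1 y2 : C) : x1 + x2 = y1 + y2 -> y2 - x2 - x1 = - y1.
      by move=> x12; rewrite -addrA -opprD [x2 + x1]addrC x12 opprD addrCA subrr addr0.
    by move=> e; apply: tr; rewrite -e; congr (_ + _); apply: mulrC.
  apply: JN; exists c1; first exact: sdomW.
  by rewrite mulrAC -[X in X ⊑ _]mul1r; apply: dom_mul (dom_refl _ _).
- move=> a; suff -> : D0 (valring_map (in_alg L) v a) = 0 by [].
  rewrite /D0 (rep_uniq _ (val a)%:P).
  + by rewrite derivC rmorph0 horner0.
  + by rewrite (leq_trans (size_polyC_leq1 _)) // (leq_trans _ hn).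
  + by rewrite map_polyC hornerC.
- rewrite /D0 (rep_uniq _ (a0^-1 *: ('X - c0%:P))).
  + rewrite derivZ derivXsubC map_polyZ hornerZ rmorph1 hornerC mulr1 fmorphV.
    case=> c cc; rewrite mulrC dom_divr // => bad.
    have := dgt c cc; rewrite /sdom.
    by rewrite (veq_dom (veq_mul (esym ac0) (erefl _))) bad.
  + by rewrite (leq_trans (size_scale_leq _ _)) // size_XsubC (leq_trans h1) // ltnW.
  + by rewrite map_polyZ map_polyXsubC hornerZ hornerXsubC iota_coordinate fmorphV mulrC.
Qed.

End Omega.

(** * Separability in towers *)

(** Any algebraic element lies in a finite extension, to which the theory of
    finite separable extensions applies. *)
Lemma adjoin_ext (K : fieldType) (L : fieldExtType K) (C : fieldType)
    (iota : {rmorphism L -> C}) (x : C) : algebraicOver iota x ->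
  exists (M : fieldExtType K) (e : {rmorphism L -> M}) (k : {rmorphism M -> C}) (y : M),
    [/\ forall b, k (e b) = iota b, forall a : K, e a%:A = a%:A & k y = x].
Proof.
move=> [p0 p00 p0x].
pose P n := `[< exists p, [/\ p != 0, root (map_poly iota p) x & size p = n] >].
have exP : exists n, P n by exists (size p0); apply/asboolP; exists p0.
case: (ex_minnP exP) => n /asboolP[p [pn0 px sp]] minn.
have irr : irreducible_poly p.
  apply/(subfx_irreducibleP px pn0) => q qx q0.
  by rewrite sp; apply: minn; apply/asboolP; exists q.
pose M1 := SubFieldExtType px irr.
pose k : {rmorphism M1 -> C} := @subfx_inj _ _ iota x p.
exists (baseFieldType M1), (in_alg M1 : {rmorphism L -> M1}), k, (subfx_root iota x p).
split=> [b|a|].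
- exact: subfx_inj_base.
- by [].
- exact: subfx_inj_root.
Qed.

Definition separable_over (F C : fieldType) (j : {rmorphism F -> C}) (x : C) : Prop :=
  exists2 p : {poly F}, separable_poly p & root (map_poly j p) x.

Lemma separable_element1P (K : fieldType) (M : fieldExtType K) (y : M) :
  separable_element 1 y <-> separable_over (in_alg M) y.
Proof.
split=> [/separable_elementP[_ [/polyOver1P[p ->] py]]|[p sp py]].
  by rewrite separable_map => sp; exists p.
apply/separable_elementP; exists (map_poly (in_alg M) p); split=> //.
  exact: alg_polyOver.
by rewrite separable_map.
Qed.

Section SeparableOver.
Variables (K : fieldType) (L : fieldExtType K) (C : fieldType).
Variable iota : {rmorphism L -> C}.
Local Notation j := (iota \o in_alg L).

Lemma separable_over_ext (M : fieldExtType K) (e : {rmorphism L -> M})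
    (k : {rmorphism M -> C}) y :
    (forall b, k (e b) = iota b) -> (forall a : K, e a%:A = a%:A) ->
  separable_over j (k y) <-> separable_element 1 y.
Proof.
move=> ke ea; have rE (p : {poly K}) :
    root (map_poly j p) (k y) = root (map_poly (in_alg M) p) y.
  have -> : map_poly j p = map_poly k (map_poly (in_alg M) p).
    by apply/polyP => i; rewrite !coef_map /= -ke ea.
  by rewrite fmorph_root.
split=> [[p sp py]|/separable_element1P[p sp py]].
  by apply/separable_element1P; exists p; rewrite -?rE.
by exists p; rewrite ?rE.
Qed.

Lemma separable_over_algebraic (F : fieldType) (i : {rmorphism F -> C}) x :
  separable_over i x -> algebraicOver i x.
Proof. by case=> p /separable_poly_neq0 p0 px; exists p. Qed.

Lemma algebraic_over_ext x : algebraicOver j x -> algebraicOver iota x.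
Proof.
case=> p p0 px; exists (map_poly (in_alg L) p); rewrite ?map_poly_eq0 //.
by rewrite -map_poly_comp.
Qed.

Variable eta : L.

Lemma separable_over_trans x : <<1; eta>>%VS = fullv ->
  separable_over j (iota eta) -> separable_over iota x -> separable_over j x.
Proof.
move=> full se sx; have [M [e [k [y [ke ea ky]]]]] :=
  adjoin_ext (separable_over_algebraic sx).
rewrite -{x}ky in sx *.
have {}se : separable_element 1 (e eta).
  by apply/(separable_over_ext _ ke ea); rewrite ke.
apply/(separable_over_ext _ ke ea).
apply: (adjoin_separable se); case: sx => p sp py.
apply/separable_elementP; exists (map_poly e p); split; last by rewrite separable_map.
  apply/polyOverP => i; rewrite coef_map /=.
  have /Fadjoin1_polyP[q ->] : p`_i \in <<1; eta>>%VS by rewrite full memvf.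
  apply/Fadjoin1_polyP; exists q; rewrite -horner_map; congr (_.[_]).
  by apply/polyP => l; rewrite !coef_map /= ea.
rewrite -(fmorph_root k); suff -> : map_poly k (map_poly e p) = map_poly iota p by [].
by apply/polyP => l; rewrite !coef_map /= ke.
Qed.

Lemma separable_over_div c c1 : c != 0 -> separable_over j c -> separable_over j c1 ->
  iota eta = c / c1 -> separable_over j (iota eta).
Proof.
move=> c0 sc sc1 e1; have ac := algebraic_over_ext (separable_over_algebraic sc).
have [M [e [k [y [ke ea ky]]]]] := adjoin_ext ac.
have c1E : c1 = k (y / e eta).
  by rewrite fmorph_div ky ke e1 invf_div mulrC divfK.
have sy : separable_element 1 y by apply/(separable_over_ext _ ke ea); rewrite ky.
have sy1 : separable_element 1 (y / e eta).
  by apply/(separable_over_ext _ ke ea); rewrite -c1E.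
rewrite -ke; apply/(separable_over_ext _ ke ea).
have y0 : y != 0 by rewrite -(fmorph_eq0 k) ky.
have -> : e eta = y / (y / e eta) by rewrite invf_div mulrC divfK.
apply: (adjoin_separable sy).
have /adjoin_separableP := separable_elementS (subv_adjoin 1 y) sy1; apply.
by rewrite rpred_div ?memv_adjoin // subvP_adjoin ?memv_adjoin.
Qed.

End SeparableOver.

(** * Degrees and indices equal to 1 *)

Lemma subgroup_index_refl (G : zmodType) (H : set G) : H 0 ->
  (forall x y, H x -> H y -> H (x - y)) -> subgroup_index H H = 1%N.
Proof.
move=> H0 HB; apply: xget_subset1.
  exists (fun _ => 0); split=> // x Hx; exists ord0; split; first by rewrite subr0.
  by move=> i _; rewrite [i]ord1.
suff one n : (exists g : 'I_n -> G, (forall i, H (g i)) /\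
    forall x, H x -> exists! i, H (x - g i)) -> n = 1%N by move=> n m /one-> /one->.
case=> g [Hg]; move/(_ _ H0) => [i [_ ui]].
case: n g Hg i ui => [|[|n]] // g Hg i ui; first by case: i {ui}.
have h k : i = k by apply: ui; apply: HB.
by have := etrans (esym (h ord0)) (h ord_max).
Qed.

Lemma subfield_degree_refl (F : fieldType) (E : set F) : E 0 -> E 1 ->
  (forall b, E b -> E (1 - b)) -> subfield_degree E E = 1%N.
Proof.
move=> E0 E1 EB; apply: xget_subset1.
  exists (fun _ => 1); split=> // x Ex; exists [ffun _ => x]; split.
    by split=> [i|]; rewrite ?ffunE // big_ord1 ffunE mulr1.
  move=> c [_ ->]; apply/ffunP => i; rewrite ffunE big_ord1 mulr1.
  by rewrite [i]ord1.
suff one n : (exists b : 'I_n -> F, is_basis E E b) -> n = 1%N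
  by move=> n m /one-> /one->.
case=> b [Eb]; case: n b Eb => [|[|n]] // b Eb span.
  by have [c [[_ /eqP]]] := span 1 E1; rewrite big_ord0 oner_eq0.
have uniq x (c c' : {ffun 'I_n.+2 -> F}) : E x -> (forall i, E (c i)) ->
    (forall i, E (c' i)) -> x = \sum_i c i * b i -> x = \sum_i c' i * b i -> c = c'.
  by move=> Ex Ec Ec' xc xc'; have [d [_ ud]] := span x Ex; rewrite -(ud c) // -(ud c').
pose i1 : 'I_n.+2 := ord_max.
pose c : {ffun 'I_n.+2 -> F} := [ffun i => (i == ord0)%:R].
(* from the relation [b1 * b0 = b0 * b1] *)
pose c' : {ffun 'I_n.+2 -> F} :=
  [ffun i => if i == ord0 then 1 - b i1 else if i == i1 then b ord0 else 0].
have rest (f : 'I_n.+2 -> F) : (forall i, i != ord0 -> i != i1 -> f i = 0) ->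
    \sum_i f i = f ord0 + f i1.
  move=> f0; rewrite (bigD1 ord0) //= (bigD1 i1) //= big1 ?addr0 //.
  by move=> i /andP[]; apply: f0.
have e : c = c'.
  apply: (uniq (b ord0)) => // [i|i||].
  - by rewrite ffunE; case: eqP.
  - by rewrite ffunE; do 2?case: eqP => // _; apply: EB.
  - rewrite rest; last by move=> i /negPf i0 _; rewrite ffunE i0 mul0r.
    by rewrite !ffunE eqxx /= mul1r mul0r addr0.
  - rewrite rest; last by move=> i /negPf i0 /negPf i1'; rewrite ffunE i0 i1' mul0r.
    by rewrite !ffunE !eqxx /= mulrBl mul1r [b i1 * _]mulrC subrK.
have b00 : b ord0 = 0.
  by have /ffunP/(_ i1) := e; rewrite !ffunE !eqxx /= => <-.
pose d : {ffun 'I_n.+2 -> F} := [ffun => 0].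
have /ffunP/(_ ord0) : c = d.
  apply: (uniq 0) => // [i|i||].
  - by rewrite ffunE; case: eqP.
  - by rewrite ffunE.
  - rewrite rest; last by move=> i /negPf i0 _; rewrite ffunE i0 mul0r.
    by rewrite !ffunE eqxx /= b00 mulr0 mul0r addr0.
  - by rewrite big1 // => i _; rewrite ffunE mul0r.
by rewrite !ffunE eqxx => /eqP; rewrite oner_eq0.
Qed.

Lemma subfield_degree1 (F : fieldType) (E k : set F) :
  subfield_degree E k = 1%N -> exists b, forall x, E x -> exists2 c, k c & x = c * b.
Proof.
move=> d1; have [[n nP]|nex] := pselect (exists n, exists b : 'I_n -> F, is_basis E k b).
  have := @xgetPex _ 0%N [set n | exists b : 'I_n -> F, is_basis E k b]%classic.
  rewrite -/(subfield_degree E k) d1; case; first by exists n.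
  move=> b [Eb span]; exists (b ord0) => x Ex.
  have [c [[kc xc] _]] := span x Ex; exists (c ord0) => //.
  by rewrite xc big_ord1.
have : subfield_degree E k = 0%N.
  by apply: xgetPN => n nP; apply: nex; exists n.
by rewrite d1.
Qed.

Lemma value_group_index (F : fieldType) (v : valuation F) :
  subgroup_index (value_group v) (value_group v) = 1%N.
Proof.
apply: subgroup_index_refl; first by exists 1; apply: v1.
move=> x y [a ax] [b bY]; exists (a / b).
have b0 : b != 0 by apply/eqP => /(v_infty v); rewrite bY.
have := vM v (a / b) b; rewrite divfK // ax bY.
by case: (v _) => //= z [->]; rewrite addrK.
Qed.

Section Henselization.
Variables (F C : fieldType) (j : {rmorphism F -> C}) (w : valuation C).

Lemma henselization0 : henselization j w 0.
Proof.
split=> [|s _ _ _]; last exact: rmorph0.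
exists 'X; last by rewrite map_polyX rootX.
by rewrite unlock derivX coprimep1.
Qed.

Lemma henselization1 : henselization j w 1.
Proof.
split=> [|s _ _ _]; last exact: rmorph1.
exists ('X - 1); last by rewrite rmorphB rmorph1 /= map_polyX root_XsubC.
by rewrite unlock derivB derivX derivC subr0 coprimep1.
Qed.

Lemma henselization_1B b : henselization j w b -> henselization j w (1 - b).
Proof.
case=> [[p sp pb] fix_b]; split; last first.
  by move=> s sbij sj sw; rewrite rmorphB rmorph1 fix_b.
exists (p \Po (1 - 'X)).
  rewrite unlock deriv_comp derivB derivX derivC sub0r mulrN1.
  rewrite -[- (_ \Po _)]scaleN1r coprimepZr ?oppr_eq0 ?oner_eq0 //.
  move: sp; rewrite unlock => sp.
  exact: coprimep_comp_poly.
rewrite map_comp_poly rmorphB rmorph1 /= map_polyX /root horner_comp !hornerE.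
by rewrite opprB addrC subrK.
Qed.

End Henselization.

(** * Generators and immediate extensions *)

Section Generator.
Variables (K : fieldType) (L : fieldExtType K) (C : closedFieldType).
Variables (iota : {rmorphism L -> C}) (eta : L).
Hypothesis full : <<1; eta>>%VS = fullv.
Local Notation j := (iota \o in_alg L).
Local Notation t := (iota eta).
Local Notation n := (\dim {:L}).
Local Notation "p ^j" := (map_poly j p) (at level 2, format "p ^j").

Lemma adjoin_degree_full : adjoin_degree 1%AS eta = n.
Proof. by have := dim_Fadjoin 1%AS eta; rewrite full dimv1 muln1 => ->. Qed.

Lemma horner_iota (f : {poly K}) : f^j.[t] = iota (map_poly (in_alg L) f).[eta].
Proof. by rewrite -horner_map -map_poly_comp. Qed.

Lemma generator_poly (z : L) :
  exists2 f : {poly K}, (size f <= n)%N & iota z = f^j.[t].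
Proof.
have /polyOver1P[f fE] := Fadjoin_polyOver 1%VS eta z.
exists f.
  by rewrite -(size_map_poly (in_alg L)) -fE -adjoin_degree_full size_Fadjoin_poly.
by rewrite horner_iota -fE (@Fadjoin_poly_eq _ _ 1%AS) // full memvf.
Qed.

Lemma generator_minpoly : exists g : {poly K},
  [/\ g \is monic, size g = n.+1, root g^j t &
      map_poly (in_alg L) g = minPoly 1 eta].
Proof.
have /polyOver1P[g gE] := @minPolyOver _ _ 1%AS eta.
have sg : size g = n.+1.
  by rewrite -(size_map_poly (in_alg L)) -gE size_minPoly adjoin_degree_full.
exists g; split=> //.
- by rewrite -(map_monic (in_alg L)) -gE monic_minPoly.
- by rewrite /root horner_iota -gE minPolyxx rmorph0.
Qed.

Variable g : {poly K}.
Hypotheses (g_monic : g \is monic) (g_size : size g = n.+1) (g_root : root g^j t).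
Hypothesis g_minpoly : map_poly (in_alg L) g = minPoly 1 eta.

Lemma minpoly_dvd (f : {poly K}) : root f^j t -> exists q, f = q * g.
Proof.
rewrite /root horner_iota fmorph_eq0 => ft.
have := @minPoly_dvdp _ _ 1%AS eta _ (alg_polyOver 1%AS f) ft.
by rewrite -g_minpoly dvdp_map => /dvdpP.
Qed.

Lemma minpoly_indep (f : {poly K}) : (size f <= n)%N -> f^j.[t] = 0 -> f = 0.
Proof.
move=> sf /rootP/minpoly_dvd[q fE]; apply: contraTeq sf => f0.
have q0 : q != 0 by apply: contraNneq f0 => q0; rewrite fE q0 mul0r.
by rewrite -ltnNge fE size_Mmonic // g_size addnS /= -[X in (X < _)%N]add0n ltn_add2r size_poly_gt0.
Qed.

Lemma minpoly_split : exists gs : seq C,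
  g^j = \prod_(z <- gs) ('X - z%:P) /\ size gs = n.
Proof.
have [gs gE] := closed_field_poly_normal g^j.
have gE' : g^j = \prod_(z <- gs) ('X - z%:P).
  by rewrite gE (monicP _) ?scale1r // map_monic.
exists gs; split=> //.
by have := size_prod_XsubC gs id; rewrite -gE' size_map_poly g_size => -[].
Qed.

End Generator.

Section Immediate.
Variables (K : fieldType) (L : fieldExtType K) (v : valuation L).
Hypothesis imm : immediate v.

Lemma immediate_scale x : x != 0 -> exists a : K, v a%:A = v x.
Proof.
move=> x0; case vx : (v x) => [y|]; last by move/(v_infty v)/eqP: vx; rewrite (negPf x0).
have : value_group v y by exists x.
by rewrite -imm.1 => -[a ay]; exists a.
Qed.

Lemma immediate_improve eta c : eta - c%:A != 0 ->
  exists c' : K, sdom v (eta - c%:A) (eta - c'%:A).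
Proof.
move=> x0; set x := eta - c%:A in x0 *; have [a ax] := immediate_scale x0.
have a0 : (a%:A : L) != 0 by rewrite (veq_eq0 ax).
have u1 : valring_pred v (x / a%:A).
  by rewrite /valring_pred -(v1 v) -/(dom v 1 _) dom_divr // mulr1 dom_eq.
have : resfield_restr (in_alg L) v (res (ValRing u1)) by rewrite imm.2.
case=> d _ /eqP; rewrite -subr_eq0 -rmorphB res_eq0 unfold_in /maxideal /= => du.
exists (c + a * val d); have -> : eta - (c + a * val d)%:A = a%:A * (x / a%:A - (val d)%:A).
  rewrite mulrBr [_%:A * (_ / _)]mulrC divfK // /x scalerDl opprD addrA; congr (_ - _).
  by rewrite -scalerAl mul1r scalerA.
rewrite -(veq_sdom ax) -[X in sdom _ X _]mulr1 sdom_mul2l //.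
by rewrite /sdom /dom v1 -vN opprB.
Qed.

End Immediate.

Lemma generator_base_unibranched (K : fieldType) (L : fieldExtType K) (v : valuation L)
    (eta : L) : <<1; eta>>%VS = fullv -> eta \in 1%VS -> unibranched v.
Proof.
move=> full eta1 w' w'v x y.
have all1 (z : L) : exists a : K, z = a%:A.
  have : z \in (1%VS : {vspace L}).
    by have /(@Fadjoin_idP _ _ 1%AS) <- := eta1; rewrite full memvf.
  by case/vlineP => a ->; exists a.
by have [a ->] := all1 x; have [b ->] := all1 y; apply: w'v.
Qed.

(** * The number of close roots *)

(** A root outside the valuation ring would make the leading term dominate
    strictly. *)
Lemma root_integral (F : fieldType) (v : valuation F) (p : {poly F}) m y :
    (size p <= m.+1)%N -> p`_m != 0 -> (forall i, dom v p`_m p`_i) -> root p y ->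
  dom v 1 y.
Proof.
move=> sp pm0 pm py; apply: contraT; rewrite sdomNge => y1.
have y0 := sdom_neq0 y1.
move: py; rewrite /root (horner_coef_wide _ sp) big_ord_recr /= addrC.
suff e : v (p`_m * y ^+ m + \sum_(i < m) p`_i * y ^+ i) = v (p`_m * y ^+ m).
  by rewrite (veq_eq0 e) mulf_eq0 (negPf pm0) expf_eq0 (negPf y0) andbF.
apply: veqDl; apply: sdom_sum => [|i _]; first by rewrite mulf_neq0 ?expf_neq0.
have -> : y ^+ m = y ^+ (m - i.+1).+1 * y ^+ i by rewrite -exprD addSnnS subnK.
apply: dom_sdom_mul => //.
rewrite -[X in sdom v _ X]mul1r; apply: sdom_dom_mul (dom_refl _ _).
  by rewrite expf_neq0.
by rewrite -(expr1n _ (m - i.+1).+1); apply: sdom_exp.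
Qed.

Section CloseRoots.
Variables (K : fieldType) (L : fieldExtType K) (v : valuation L).
Variables (C : closedFieldType) (iota : {rmorphism L -> C}) (w : valuation C).
Hypothesis w_ext : vequiv (vrestr iota w) v.
Local Notation j := (iota \o in_alg L).
Local Notation "x ⊑ y" := (dom w x y) (at level 70).
Local Notation "x ⊏ y" := (sdom w x y) (at level 70).
Local Notation "p ^j" := (map_poly j p) (at level 2, format "p ^j").
Local Notation n := (\dim {:L}).
Variable eta : L.
Local Notation t := (iota eta).
Hypothesis full : <<1; eta>>%VS = fullv.
Hypothesis nomax : forall c, exists c', t - j c ⊏ t - j c'.
Hypothesis scale : forall c, exists a, w (j a) = w (t - j c).
Hypothesis pure : forall f : {poly K}, (size f <= n)%N ->
  exists c, forall b, t - j c ⊑ t - j b -> w (j f.[b]) = w (j f.[c]).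
Variables (g : {poly K}) (gs : seq C).
Hypotheses (g_monic : g \is monic) (g_size : size g = n.+1) (g_root : root g^j t).
Hypothesis g_minpoly : map_poly (in_alg L) g = minPoly 1 eta.
Hypothesis g_split : g^j = \prod_(z <- gs) ('X - z%:P).

Local Notation h := (clnum j w t gs).
Local Notation D := (farprod j w t gs).
Local Notation near := (near j w t).
Local Notation close := (close j w t).

(** If all roots are close, the coordinates of small discs are integral over the
    base, so every prolongation of the valuation of [K] gives [f(eta)] the value
    of [f] at an approximation of [eta]. *)
Lemma all_close_unibranched : h = n -> unibranched v.
Proof.
move=> hn w' w'v.
have base (x y : K) : dom w' x%:A y%:A = (j x ⊑ j y).
  by rewrite -(dom_ext w_ext); apply: w'v.
have key (z : L) : near (fun c => exists d : K, w' z = w' d%:A /\ w (iota z) = w (j d)).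
  have [f sf zf] := generator_poly iota full z.
  have [f0|f0] := eqVneq f 0.
    apply: near_all => c; exists 0; rewrite /= scale0r !rmorph0.
    by move/eqP: zf; rewrite f0 rmorph0 horner0 fmorph_eq0 => /eqP ->; rewrite rmorph0.
  have npk := pure_peak nomax pure f0 sf.
  have nval := pure_val nomax pure sf.
  apply: near_imp (near_and (near_far_in j w t gs) (near_and npk nval)).
  move=> c [fc [pk fv]]; have [a ac] := scale c.
  have ja0 : j a != 0 by rewrite (veq_eq0 ac) (t_neq nomax).
  have a0 : a != 0 by rewrite -(fmorph_eq0 j).
  have aL0 : (a%:A : L) != 0 by rewrite -(fmorph_eq0 iota).
  exists f.[c]; split; last by rewrite zf fv horner_map.
  pose y := (eta - c%:A) / a%:A.
  have yE (p : {poly K}) : (map_poly (in_alg L) (aff c a p)).[y] = (map_poly (in_alg L) p).[eta].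
    by rewrite map_aff horner_aff /y mulrC divfK // subrK.
  have y1 : dom w' 1 y.
    have gpk : peak w ltn (j a ^+ h * D) h (aff c a g)^j.
      apply: g_peak_ltn; rewrite ?(veq_dom ac) ?dom_refl //.
      by move=> x xs cx; rewrite (veq_sdom ac); apply: fc.
    apply: (@root_integral _ w' (map_poly (in_alg L) (aff c a g)) n).
    - by rewrite size_map_poly size_aff // g_size.
    - rewrite coef_map fmorph_eq0 -(fmorph_eq0 j); have := peak_coef gpk.
      by rewrite hn coef_map; case.
    - move=> i; rewrite !coef_map base; have [_ + _ _] := peak_coef gpk.
      by rewrite hn => /(_ i); rewrite !coef_map.
    - by rewrite /root yE g_minpoly minPolyxx.
  have pk' : peak w' ltn (f.[c]%:A) 0 (map_poly (in_alg L) (aff c a f)).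
    have := pk _ ac; rewrite -map_aff horner_map.
    case=> [e0 le e lt]; split.
    - by rewrite -(fmorph_eq0 iota).
    - by move=> i; rewrite coef_map base; have := le i; rewrite coef_map.
    - rewrite coef_map; apply: dom_anti; rewrite base;
      by apply: dom_eq; rewrite -e coef_map.
    - by move=> i /lt; rewrite /sdom !coef_map /= base.
  have := peak_horner pk' y1; rewrite yE => <-; congr (vfun w' _).
  by apply: (fmorph_inj iota); rewrite -horner_iota.
move=> x y; have [c [[d [xw' xw]] [e [yw' yw]]]] := near_ex (near_and (key x) (key y)).
rewrite -/(dom w' x y) -/(dom v x y) (veq_dom xw') (veq_dom yw') base.
by rewrite (dom_ext w_ext) (veq_dom xw) (veq_dom yw).
Qed.

Lemma close_unique x y : h = 1%N -> x \in gs -> y \in gs -> close x -> close y -> x = y.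
Proof.
rewrite /clnum -size_filter => h1 xs ys cx cy.
have xf : x \in filter close gs by rewrite mem_filter cx.
have yf : y \in filter close gs by rewrite mem_filter cy.
by case: (filter close gs) h1 xf yf => [|u [|]] // _; rewrite !inE => /eqP -> /eqP ->.
Qed.

(** With a single close root, the automorphisms preserving the valuation fix
    [L], and [L] is separable over [K]: the henselizations agree. *)
Lemma henselization_eq : h = 1%N -> henselization iota w = henselization j w.
Proof.
move=> h1; have st : separable_over j t.
  exists g => //; have : separable_element 1%AS eta.
    rewrite separable_nz_der -g_minpoly deriv_map map_poly_eq0.
    apply/eqP => g'0; have := deriv_val_simple g_split g_root h1.
    by rewrite g'0 rmorph0 horner0 => /eqP; rewrite eq_sym (negPf (farprod_neq0 _ _ _ _)).
  by rewrite /separable_element -g_minpoly separable_map.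
apply/seteqP; split=> x [sx fx]; split.
- exact: (separable_over_trans full st sx).
- move=> s sbij sj sw; apply: fx => // z.
  have stt : s t = t.
    have ts : t \in gs by apply: t_root g_split g_root.
    have sts : s t \in gs.
      rewrite -root_prod_XsubC -g_split /root.
      have -> : g^j = map_poly s g^j by apply/polyP => i; rewrite !coef_map /= sj.
      by rewrite horner_map (rootP g_root) rmorph0.
    apply: close_unique => //; last exact: close_refl.
    apply/asboolP => c; have -> : t - s t = (t - j c) - (s t - j c).
      by rewrite opprB addrA subrK.
    apply: dom_B (dom_refl _ _) _.
    by rewrite -[X in dom _ _ (_ - X)](sj c) -(rmorphB s); apply/dom_eq/esym/sw.
  have [f _ ->] := generator_poly iota full z.
  rewrite -{2}stt -horner_map; congr (_.[_]).
  by apply/polyP => i; rewrite !coef_map /= sj.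
- case: sx => p sp px; exists (map_poly (in_alg L) p); first by rewrite separable_map.
  by rewrite -map_poly_comp.
- by move=> s sbij siota sw; apply: fx => // a; apply: siota.
Qed.

Hypothesis algC : forall x : C, algebraicOver j x.

(** Modulo [g], every polynomial over [K] has degree less than [n], hence only
    far roots, and its values at [t] and at a close root agree. *)
Lemma conjugation_corr t' : t' \in gs -> close t' ->
  valued_corr w (fun a b => exists f : {poly K}, a = f^j.[t] /\ b = f^j.[t']).
Proof.
move=> ts ct.
have gt' : root g^j t' by rewrite g_split root_prod_XsubC.
have val (f : {poly K}) : w f^j.[t] = w f^j.[t'].
  have sr : (size (f %% g)%R <= n)%N.
    by rewrite -ltnS -g_size ltn_modp monic_neq0.
  have red z : root g^j z -> f^j.[z] = (f %% g)^j.[z].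
    move=> gz; rewrite [in LHS](divp_eq f g) rmorphD rmorphM /= hornerD hornerM.
    by rewrite (rootP gz) mulr0 add0r.
  by rewrite !red //; apply/esym/(pure_val_close nomax pure).
split.
- by exists 1; rewrite rmorph1 !hornerC.
- by move=> _ _ _ _ [p [-> ->]] [q [-> ->]]; exists (p - q); rewrite rmorphB !hornerE.
- by move=> _ _ _ _ [p [-> ->]] [q [-> ->]]; exists (p * q); rewrite rmorphM !hornerE.
- move=> _ _ [p [-> ->]]; have [p0|p0] := eqVneq p^j.[t] 0.
    exists 0; rewrite rmorph0 !horner0; split; apply/eqP; rewrite invr_eq0.
      by rewrite p0.
    by rewrite -(veq_eq0 (val p)) p0.
  have [q _] := generator_poly iota full ((map_poly (in_alg L) p).[eta])^-1.
  rewrite fmorphV -horner_iota => qt; exists q; split=> //.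
  have p't : p^j.[t'] != 0 by rewrite -(veq_eq0 (val p)).
  apply: (mulfI p't); rewrite divff //; apply/esym/eqP; rewrite -subr_eq0.
  have := val (p * q - 1); rewrite rmorphB rmorphM rmorph1 !hornerE -qt divff // subrr.
  by move/veq_eq0; rewrite eqxx => /esym.
- by move=> _ _ [p [-> ->]].
Qed.

(** Conversely, a second close root is the image of [t] under an automorphism
    preserving the valuation, so [t] is not in the henselization of [K]. *)
Lemma degree1_clnum :
    subfield_degree (henselization iota w) (henselization j w) = 1%N -> h = 1%N.
Proof.
move=> /subfield_degree1[b0 b0P].
have [c1 [sc1 fc1] e1] := b0P 1 (henselization1 iota w).
have Ht : henselization iota w t.
  split; last by move=> s _ si _; apply: si.
  exists ('X - eta%:P); last by rewrite map_polyXsubC root_XsubC.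
  by rewrite unlock derivB derivX derivC subr0 coprimep1.
have [c [sc fc] e] := b0P t Ht.
have c10 : c1 != 0.
  by apply: contraTneq isT => c10; move/eqP: e1; rewrite c10 mul0r oner_eq0.
have tE : t = c / c1.
  by rewrite e; congr (_ * _); apply: (mulfI c10); rewrite divff.
have t0 : t != 0 by have := t_neq nomax 0; rewrite rmorph0 subr0.
have c0 : c != 0 by apply: contraNneq t0 => c0; rewrite tE c0 mul0r.
have [p sp pt] := separable_over_div c0 sc sc1 tE.
have ugs : uniq gs.
  rewrite -separable_prod_XsubC -g_split separable_map.
  have [q pE] := minpoly_dvd g_minpoly pt.
  by apply: dvdp_separable sp; rewrite pE dvdp_mulIr.
apply/eqP; rewrite eqn_leq (clnum_gt0 w g_split g_root) andbT leqNgt.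
apply/negP => h2.
have [t' [ts ct tt]] : exists t', [/\ t' \in gs, close t' & t' <> t].
  have uf : uniq (filter close gs) by rewrite filter_uniq.
  move: h2; rewrite /clnum -size_filter; case E : (filter close gs) uf => [|x [|y r]] //=.
  rewrite inE negb_or => /andP[/andP[xy _] _] _.
  have inf z : z \in [:: x, y & r] -> z \in gs /\ close z.
    by rewrite -E mem_filter => /andP[].
  have [xs cx] := inf x (mem_head _ _).
  have [ys cy] : y \in gs /\ close y by apply: inf; rewrite !inE eqxx orbT.
  have [xt|xt] := eqVneq x t; last by exists x; split=> //; apply/eqP.
  by exists y; split=> //; apply/eqP; rewrite -xt eq_sym.
have jG a : exists f : {poly K}, j a = f^j.[t] /\ j a = f^j.[t'].
  by exists a%:P; rewrite !map_polyC !hornerC.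
have [s [sbij sw sG]] := corr_automorphism algC (conjugation_corr ts ct) jG.
have sj a : s (j a) = j a by apply: sG.
have st : s t = t' by apply: sG; exists 'X; rewrite map_polyX !hornerX.
by apply: tt; rewrite -st tE fmorph_div fc ?fc1.
Qed.

End CloseRoots.

Theorem proposition6p7 (K : fieldType) (L : fieldExtType K) (v : valuation L)
    (Kbar : closedFieldType) (iota : {rmorphism L -> Kbar})
    (algKbar : forall x : Kbar, algebraicOver (iota \o in_alg L) x)
    (vbar : valuation Kbar) (vbar_ext : vequiv (vrestr iota vbar) v) :
  branched_pure v ->
  ((forall x : Omega v, x = 0) <-> defect v iota vbar = 1).
Proof.
case=> [[eta [full imm vpure]] nuni].
have eta1 : eta \notin 1%VS.
  by apply/negP => eta1; apply: nuni; apply: generator_base_unibranched full eta1.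
have etaN c : eta - c%:A != 0.
  by apply: contraNneq eta1 => /eqP; rewrite subr_eq0 => /eqP ->; rewrite memvZ ?mem1v.
pose j : {rmorphism K -> Kbar} := iota \o in_alg L.
pose t := iota eta.
have ext x y : dom v x y = dom vbar (iota x) (iota y) by apply: dom_ext.
have extE x y : v x = v y -> vbar (iota x) = vbar (iota y).
  by move=> e; apply: dom_anti; rewrite -ext dom_eq.
have tB c : t - j c = iota (eta - c%:A) by rewrite rmorphB.
have nomax c : exists c', sdom vbar (t - j c) (t - j c').
  have [c' cc'] := immediate_improve imm (etaN c).
  by exists c'; rewrite !tB /sdom -ext.
have scale c : exists a, vbar (j a) = vbar (t - j c).
  by have [a ac] := immediate_scale imm (etaN c); exists a; rewrite tB; apply: extE.
have pure (f : {poly K}) : (size f <= \dim {:L})%N ->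
    exists c, forall b, dom vbar (t - j c) (t - j b) -> vbar (j f.[b]) = vbar (j f.[c]).
  move=> /vpure[c fc]; exists c => b; rewrite !tB -ext => cb.
  exact: extE (fc b cb).
have [g [gm gsz gr gmin]] := generator_minpoly iota full.
have [gs [gsplit gssz]] := minpoly_split iota gm gsz.
have gen := generator_poly iota full.
have indep := minpoly_indep gm gsz gmin.
have hn : (clnum j vbar t gs < \dim {:L})%N.
  rewrite ltn_neqAle; apply/andP; split; last by rewrite -gssz; apply: count_size.
  apply/eqP => hn; apply: nuni.
  exact: (all_close_unibranched vbar_ext full nomax scale pure gsz gmin gsplit hn).
have defectE : defect v iota vbar =
    (subfield_degree (henselization iota vbar) (henselization j vbar))%:R.
  rewrite /defect imm.1 imm.2 value_group_index subfield_degree_refl //.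
  by rewrite divr1.
have [h1|h1] := eqVneq (clnum j vbar t gs) 1%N.
  split=> _.
    rewrite defectE (henselization_eq full gr gmin gsplit h1).
    rewrite subfield_degree_refl //; first exact: henselization0.
      exact: henselization1.
    exact: henselization_1B.
  exact: (Omega_zero vbar_ext nomax scale pure gsplit gr gen h1).
have h2 : (1 < clnum j vbar t gs)%N.
  by rewrite ltn_neqAle eq_sym h1; exact: (clnum_gt0 vbar gsplit gr).
split=> [O0|d1]; exfalso.
  have gdvd (f : {poly K}) : root (map_poly j f) t -> exists q, f = q * g.
    exact: minpoly_dvd gmin _.
  have ind (f : {poly K}) : (size f <= \dim {:L})%N -> (map_poly j f).[t] = 0 -> f = 0.
    exact: indep.
  have := Omega_nonzero vbar_ext nomax scale pure gsplit gr gen ind gdvd h2 hn.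
  exact.
move/eqP: h1; apply; apply: (degree1_clnum full nomax pure gm gsz gr gmin gsplit algKbar).
move/eqP: d1; rewrite defectE -[1]/(1%:R) Num.Theory.eqr_nat => /eqP; exact.
Qed.
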